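(* Let $d,d'\in\mathbb{N}$ (zero allowed), let $(a_k)_{0\le k\le d}$ and $(b_k)_{0\le k\le d'}$ be real numbers, and consider the polynomials $A_d(\xi)=\sum_{k=0}^d a_k\xi^k$ and $B_{d'}(\xi)=\sum_{k=0}^{d'}b_k\xi^k$. Suppose that the real random variable $F$ has a differentiable characteristic function $\phi_F(\xi)=\mathbb{E}[e^{i\xi F}]$ such that $$A_d(i\xi)\,\phi_F'(\xi)=i\,B_{d'}(i\xi)\,\phi_F(\xi)\qquad\text{for all }\xi\in\mathbb{R}.$$ Define the differential operators $\mathcal{A}_d=\sum_{k=0}^d a_k\frac{d^k}{dx^k}$ and $\mathcal{B}_{d'}=\sum_{k=0}^{d'}b_k\frac{d^k}{dx^k}$. Let $Y$ be a real valued random variable such that $\mathbb{E}[|Y|]<+\infty$. Then $Y$ has the same law as $F$ if and only if $$\mathbb{E}\left[Y\,\mathcal{A}_df(Y)-\mathcal{B}_{d'}f(Y)\right]=0\qquad\text{for all } f\in\mathcal{S}(\mathbb{R}).$$ Moreover, the differential operator $f\mapsto\mathcal{A}_\infty f$, $\mathcal{A}_\infty f(x)=x\,\mathcal{A}_df(x)-\mathcal{B}_{d'}f(x)$, is a Stein operator for $F$ with Stein class $\mathcal{S}(\mathbb{R})$, i.e. $\mathbb{E}[\mathcal{A}_\infty f(F)]=0$ for all $f\in\mathcal{S}(\mathbb{R})$.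
   Context: $\mathcal{S}(\mathbb{R})$ denotes the Schwartz space of smooth, rapidly decreasing functions on $\mathbb{R}$; $i$ is the imaginary unit.
   Formalization: The coefficients a_k and b_k are assumed not all zero; if they all vanish, the equation for the characteristic function is 0 = 0 and the expectation condition holds for every Y, so the ''if'' part is false (e.g. F = 0, Y = 1). *)

(* Defs.v *)
From HB Require Import structures.
From mathcomp Require Import all_boot all_order all_algebra.
From mathcomp Require Import all_classical all_reals all_analysis.
From mathcomp Require Import complex.

Set Implicit Arguments.
Unset Strict Implicit.
Unset Printing Implicit Defensive.

Import Order.TTheory GRing.Theory Num.Theory.
Import numFieldNormedType.Exports.

Local Open Scope classical_set_scope.
Local Open Scope ring_scope.
Local Open Scope complex_scope.

(* e^{it} for real t. *)
Definition expi (R : realType) (t : R) : R[i] := cos t +i* sin t.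

(* Expectation of a complex random variable. As 'E_P takes values in \bar R,
   `fine` brings it back to R; it loses nothing for bounded variables. *)
Definition Cexpectation (d : measure_display) (T : measurableType d)
    (R : realType) (P : probability T R) (Z : T -> R[i]) : R[i] :=
  fine 'E_P[fun w => complex.Re (Z w)]%E
    +i* fine 'E_P[fun w => complex.Im (Z w)]%E.

Definition char_fun (d : measure_display) (T : measurableType d)
    (R : realType) (P : probability T R) (X : {RV P >-> R}) (xi : R) : R[i] :=
  Cexpectation P (fun w => expi (xi * X w)).
Arguments char_fun {d T R} P X xi.

(* MathComp-Analysis has no normed R-module structure on R[i], so
   differentiation of a complex-valued function of a real variable is
   componentwise. *)
Definition Cderivable (R : realType) (phi : R -> R[i]) (x : R) : Prop :=
  derivable (fun t => complex.Re (phi t)) x 1 /\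
  derivable (fun t => complex.Im (phi t)) x 1.

Definition Cderive (R : realType) (phi : R -> R[i]) (x : R) : R[i] :=
  (fun t => complex.Re (phi t))^`()%classic x +i* (fun t => complex.Im (phi t))^`()%classic x.

Definition smooth (R : realType) (f : R -> R) : Prop :=
  forall (n : nat) (x : R), derivable (f^`(n)%classic) x 1.

Definition rapidly_decreasing (R : realType) (f : R -> R) : Prop :=
  forall m n : nat, exists C : R, forall x : R, `|x ^+ m * f^`(n)%classic x| <= C.

(* Real-valued Schwartz functions. *)
Definition schwartz (R : realType) : set (R -> R) :=
  [set f | smooth f /\ rapidly_decreasing f].

Definition symbol (R : realType) (d : nat) (a : 'I_d.+1 -> R) (z : R[i]) : R[i] :=
  \sum_(k < d.+1) (a k)%:C * z ^+ k.

Definition diff_op (R : realType) (d : nat) (a : 'I_d.+1 -> R)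
    (f : R -> R) (x : R) : R :=
  \sum_(k < d.+1) a k * f^`(k)%classic x.

Definition stein_op (R : realType) (d d' : nat)
    (a : 'I_d.+1 -> R) (b : 'I_d'.+1 -> R) (f : R -> R) (x : R) : R :=
  x * diff_op a f x - diff_op b f x.

Definition same_law (R : realType) (d1 d2 : measure_display)
    (T1 : measurableType d1) (T2 : measurableType d2)
    (P1 : probability T1 R) (P2 : probability T2 R)
    (X1 : {RV P1 >-> R}) (X2 : {RV P2 >-> R}) : Prop :=
  forall A : set R, measurable A -> distribution P1 X1 A = distribution P2 X2 A.
Arguments same_law {R d1 d2 T1 T2} P1 P2 X1 X2.

(* `opA` is a Stein operator for X with Stein class S. The extended expectation
   can only be 0 when opA f (X) is integrable, because +oo - +oo is -oo. *)
Definition is_stein_operator (d : measure_display) (T : measurableType d)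
    (R : realType) (P : probability T R) (X : {RV P >-> R})
    (opA : (R -> R) -> (R -> R)) (S : set (R -> R)) : Prop :=
  forall f : R -> R, S f -> 'E_P[fun w => opA f (X w)]%E = 0%E.
Arguments is_stein_operator {d T R} P X opA S.

(* Main.v *)
(* Everything is expressed through the laws mu of F and nu of Y.  Cancelling the
   largest common power of i xi from A and B (by continuity the equation survives
   at xi = 0) and evaluating at 0, where phi_F = 1, shows that the new a_0 is not
   zero.  The equation then bounds the second difference quotients of Re phi_F at
   0, so E[F^2] is finite.

   For a law with finite mean, the Stein identity on Schwartz functions is
   equivalent to the differential equation: Fourier inversion (with exponential
   damping, that is, Poisson kernels) reduces Schwartz functions to the functions
   cos (xi x + th), which are conversely limits of their products with wide
   Gaussians.  In particular one may again cancel powers of i xi, and assume that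
   a_0 is not zero in the Stein identity of Y.

   Solving the equation is not enough for uniqueness, since A (i xi) may vanish.
   Instead, testing the Stein identity against logistic functions that increase to
   exp (s x) yields E[exp (s |Y|)] < oo for some s > 0, and testing it against
   powers gives a recurrence that determines all the moments.  The moments of F
   and Y thus coincide, the characteristic functions and all their derivatives
   agree at 0, and Taylor expansions of a fixed radius carry the agreement along
   the whole line.  Finally equal characteristic functions give equal integrals of
   Schwartz functions, then of logistic functions, hence of indicators of rays. *)
Require Import Defs.
From HB Require Import structures.
From mathcomp Require Import all_boot all_order all_algebra.
From mathcomp Require Import all_classical all_reals all_analysis.
From mathcomp Require Import measurable_realfun.
From mathcomp Require Import complex.
From mathcomp Require Import ring lra zify.

Set Implicit Arguments.
Unset Strict Implicit.
Unset Printing Implicit Defensive.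

Import Order.TTheory GRing.Theory Num.Theory.
Import numFieldNormedType.Exports.

Local Open Scope classical_set_scope.
Local Open Scope ring_scope.
Local Open Scope complex_scope.

(** * Iterated derivatives *)

(** The hypothesis [ab_neq0] is what the cancellation rests on: with all coefficients zero, the
    equation and the Stein identity say nothing about a law.

    Differentiability of phi_F does not by itself give F a mean, and phi_F' is not known to be
    continuous. Hence the detour through second differences: since 1 - cos is nonnegative, Fatou's
    lemma turns a bound on them into a second moment, and mean value arguments stand in for the
    missing continuity at 0.

    Logistic functions fit the exponential moments because they are bounded with bounded
    derivatives, and the logistic equation f' = s f (1 - e f) expresses the k-th derivative as s^k f
    times a polynomial in e f, which stays in [0, 1]. A small s thus controls all the higher terms
    at once.

    Almost everything is kept real: i^k is a shift of phase by k pi / 2, and the single family cos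
    (xi x + th) stands for both parts of exp (i xi x). *)

Section pointwise_derivatives.
Context {R : realType}.
Implicit Types (f g : R -> R) (x a b c : R).

(** These rules are stated for explicit lambda terms, so that they compose as proof terms and leave
    a single identity for [ring] or [field]. *)
Lemma is_derive1D f g x a b : is_derive x (1 : R) f a -> is_derive x (1 : R) g b ->
  is_derive x (1 : R) (fun y => f y + g y) (a + b).
Proof. exact: is_deriveD. Qed.

Lemma is_derive1N f x a : is_derive x (1 : R) f a ->
  is_derive x (1 : R) (fun y => - f y) (- a).
Proof. exact: is_deriveN. Qed.

Lemma is_derive1M f g x a b : is_derive x (1 : R) f a -> is_derive x (1 : R) g b ->
  is_derive x (1 : R) (fun y => f y * g y) (a * g x + f x * b).
Proof.
move=> fa gb; apply: (is_derive_eq (is_deriveM fa gb)).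
by rewrite addrC /GRing.scale /= (mulrC a).
Qed.

Lemma is_derive1Z f x a c : is_derive x (1 : R) f a ->
  is_derive x (1 : R) (fun y => c * f y) (c * a).
Proof. by move=> fa; exact: (is_deriveZ c fa). Qed.

Lemma is_derive1_compose f g x a b :
  is_derive (g x) (1 : R) f a -> is_derive x (1 : R) g b ->
  is_derive x (1 : R) (fun y => f (g y)) (a * b).
Proof. exact: is_derive1_comp. Qed.

Lemma is_derive1X n x : is_derive x (1 : R) (fun y => y ^+ n) (n%:R * x ^+ n.-1).
Proof.
have -> : (fun y : R => y ^+ n) = (id : R -> R) ^+ n.
  by apply/funext => y; rewrite exprfctE.
apply: (is_derive_eq (is_deriveX n (is_derive_id x (1 : R)))).
by rewrite /GRing.scale /= mulr1.
Qed.

Lemma is_derive1V f x a : f x != 0 -> is_derive x (1 : R) f a ->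
  is_derive x (1 : R) (fun y => (f y)^-1) (- (a / f x ^+ 2)).
Proof.
move=> fx fa; apply: (is_derive_eq (is_deriveV fx fa)).
by rewrite /GRing.scale /= mulNr mulrC.
Qed.

End pointwise_derivatives.

(** * Towers of derivatives, Leibniz products, Gaussians *)

Section towers.
Context {R : realType}.
Implicit Types f g : nat -> R -> R.

(** A function comes with explicit candidates for all its derivatives, so that iterated derivatives
    never have to be computed; [tower_derive1n] identifies them afterwards. *)
Definition derivative_tower f :=
  forall k (x : R), is_derive x (1 : R) (f k) (f k.+1 x).

Lemma is_derive_continuous (f : R -> R) (x df : R) :
  is_derive x (1 : R) f df -> {for x, continuous f}.
Proof.
by move=> fx; apply/differentiable_continuous/derivable1_diffP/ex_derive.
Qed.

Lemma tower_continuous f k : derivative_tower f -> continuous (f k).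
Proof. by move=> tf x; apply: is_derive_continuous (tf k x). Qed.

Lemma tower_measurable f k : derivative_tower f -> measurable_fun setT (f k).
Proof. by move=> tf; apply: continuous_measurable_fun; exact: tower_continuous. Qed.

Lemma tower_derive1n f k : derivative_tower f -> (f 0%N)^`(k)%classic = f k.
Proof.
move=> tf; elim: k => [//|k IH]; rewrite derive1nS IH.
by apply/funext => x; rewrite derive1E; have [] := tf k x.
Qed.

Lemma tower_schwartz f : derivative_tower f ->
  (forall m n, exists C : R, forall x, `|x ^+ m * f n x| <= C) ->
  schwartz (f 0%N).
Proof.
move=> tf bf; split=> [n x|m n]; rewrite tower_derive1n //.
by have [] := tf n x.
Qed.

Lemma schwartz_tower (f : R -> R) : schwartz f ->
  derivative_tower (fun k => f^`(k)%classic).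
Proof.
by move=> [sf _] k x; apply: DeriveDef; [exact: sf | rewrite derive1nS derive1E].
Qed.

Lemma tower_shift f : derivative_tower f -> derivative_tower (fun k => f k.+1).
Proof. by move=> tf k; exact: tf. Qed.

(** Leibniz rule as a binary tree with 2^k leaves instead of binomial coefficients; only crude
    bounds and limits of it are used. *)
Fixpoint prod_tower f g k {struct k} : R -> R :=
  if k is k'.+1 then
    prod_tower (fun i => f i.+1) g k' + prod_tower f (fun i => g i.+1) k'
  else f 0%N * g 0%N.

Lemma derivative_prod_tower f g :
  derivative_tower f -> derivative_tower g -> derivative_tower (prod_tower f g).
Proof.
move=> tf tg k; elim: k f g tf tg => [|k IH] f g tf tg x.
  exact: is_derive1M (tf 0%N x) (tg 0%N x).
have h1 := IH _ _ (tower_shift tf) tg x.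
have h2 := IH _ _ tf (tower_shift tg) x.
exact: is_deriveD h1 h2.
Qed.

(** Each of the 2^k leaves is a product of some [f i] and [g j] with i + j = k. The weight c is
    there to carry a power of |x|. *)
Lemma prod_tower_le f g k (x c B : R) : 0 <= c ->
  (forall i j, (i + j = k)%N -> c * `|f i x * g j x| <= B) ->
  c * `|prod_tower f g k x| <= 2 ^+ k * B.
Proof.
move=> c0; elim: k f g => [|k IH] f g H.
  by rewrite expr0 mul1r; exact: H.
rewrite /= fctE exprS -mulrA mulr_natl mulr2n.
apply: le_trans (ler_wpM2l c0 (ler_normD _ _)) _; rewrite mulrDr.
apply: lerD; apply: IH => i j ij; apply: H.
  by rewrite addSn ij.
by rewrite addnS ij.
Qed.

(** When the [g n] tend to a constant and their derivatives to 0, only the leaf with all the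
    derivatives on f survives. *)
Lemma prod_tower_cvg f (g : nat -> nat -> R -> R) (l : nat -> R) k (x : R) :
  (forall j, g ^~ j ^~ x @ \oo --> l j) -> (forall j, l j.+1 = 0) ->
  (fun n => prod_tower f (g n) k x) @ \oo --> f k x * l 0%N.
Proof.
elim: k f g l => [|k IH] f g l gl l0.
  by rewrite /= ; apply: cvgM; [exact: cvg_cst | exact: gl].
have -> : f k.+1 x * l 0%N = f k.+1 x * l 0%N + f k x * l 1%N.
  by rewrite l0 mulr0 addr0.
apply: cvgD; first exact: (IH (fun i => f i.+1) g).
exact: (IH f (fun n i => g n i.+1) (fun j => l j.+1)).
Qed.

Lemma scale_tower f (d : R) : derivative_tower f ->
  derivative_tower (fun k x => d ^+ k * f k (d * x)).
Proof.
move=> tf k x.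
have dx := is_derive1Z d (is_derive_id x (1 : R)).
apply: (is_derive_eq (is_derive1Z (d ^+ k) (is_derive1_compose (tf k (d * x)) dx))).
by rewrite exprS; ring.
Qed.

Lemma poly_expR_le (p : {poly R}) :
  exists C : R, forall x, `|p.[x] * expR (- x ^+ 2)| <= C.
Proof.
have mon n : exists C : R, forall x : R, `|x ^+ n * expR (- x ^+ 2)| <= C.
  (* The 1 serves for |x| <= 1, where |x|^n <= 1 <= exp (x^2). For |x| > 1, |x|^n is at most
     (x^2)^(n+1), which a single term of the exponential series dominates. *)
  exists (1 + n.+1`!%:R) => x.
  rewrite normrM normrX (ger0_norm (expR_ge0 _)) expRN.
  rewrite ler_pdivrMr ?expR_gt0 //.
  have x2 : 0 <= x ^+ 2 by exact: sqr_ge0.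
  have h := expR_ge1Dxn n x2.
  have e1 : 1 <= expR (x ^+ 2).
    by apply: le_trans h; rewrite lerDl divr_ge0 // exprn_ge0.
  have e2 : (x ^+ 2) ^+ n.+1 <= n.+1`!%:R * expR (x ^+ 2).
    rewrite mulrC -ler_pdivrMr ?ltr0n ?fact_gt0 //.
    by apply: le_trans h; rewrite lerDr.
  rewrite mulrDl mul1r.
  have [x1|x1] := leP `|x| 1.
    by rewrite (le_trans (exprn_ile1 _ (normr_ge0 x) x1)) // (le_trans e1) // lerDl mulr_ge0 // expR_ge0.
  rewrite -[leLHS]add0r; apply: lerD; first exact: expR_ge0.
  apply: le_trans e2; rewrite -exprM -[leRHS]ger0_norm ?exprn_even_ge0 ?oddM //.
  by rewrite normrX; apply: ler_weXn2l; [exact: ltW | lia].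
elim/poly_ind: p => [|p c [C HC]].
  by exists 0 => x; rewrite horner0 mul0r normr0.
have [D HD] : exists D : R, forall x : R, `|x * (p.[x] * expR (- x ^+ 2))| <= D.
  (* A bound for p says nothing about x p(x), so the induction is run for all the powers x^m at
     once. *)
  suff : forall m, exists D : R, forall x : R, `|x ^+ m * (p.[x] * expR (- x ^+ 2))| <= D.
    by move=> /(_ 1%N).
  move=> m; elim/poly_ind: p m {C HC} => [|p d IH] m.
    by exists 0 => x; rewrite horner0 !(mul0r, mulr0) normr0.
  have [D1 H1] := IH m.+1; have [D2 H2] := mon m.
  exists (D1 + `|d| * D2) => x.
  have -> : x ^+ m * ((p * 'X + d%:P).[x] * expR (- x ^+ 2)) =
     x ^+ m.+1 * (p.[x] * expR (- x ^+ 2)) + d * (x ^+ m * expR (- x ^+ 2)).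
    by rewrite hornerMXaddC (exprS x m); ring.
  apply: le_trans (ler_normD _ _) _; apply: lerD => //.
  by rewrite normrM; apply: ler_wpM2l.
have [E HE] := mon 0%N.
exists (D + `|c| * E) => x.
have -> : (p * 'X + c%:P).[x] * expR (- x ^+ 2) =
     x * (p.[x] * expR (- x ^+ 2)) + c * (x ^+ 0 * expR (- x ^+ 2)).
  by rewrite hornerMXaddC; ring.
apply: le_trans (ler_normD _ _) _; apply: lerD => //.
by rewrite normrM; apply: ler_wpM2l.
Qed.

(** Up to the sign (-1)^k, these are the Hermite polynomials of the weight exp (- x^2). *)
Fixpoint gauss_poly k : {poly R} :=
  if k is k'.+1 then (gauss_poly k')^`() - 2%:P * 'X * gauss_poly k' else 1.

Definition gauss_tower k (x : R) := (gauss_poly k).[x] * expR (- x ^+ 2).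

Lemma derivative_gauss_tower : derivative_tower gauss_tower.
Proof.
move=> k x.
have dx := is_derive1N (is_derive1X 2 x).
have h := is_derive1M (is_derive_poly (gauss_poly k) x)
  (is_derive1_compose (x := x) (is_derive_expR _) dx).
apply: (is_derive_eq h).
rewrite /gauss_tower /= hornerD hornerN !hornerM hornerC hornerX.
by ring.
Qed.

Lemma gauss_tower_le m k :
  exists C : R, forall x, `|x ^+ m * gauss_tower k x| <= C.
Proof.
have [C HC] := poly_expR_le ('X^m * gauss_poly k).
by exists C => x; have := HC x; rewrite hornerM hornerXn mulrA.
Qed.

Lemma gauss_tower00 : gauss_tower 0 0 = 1.
Proof. by rewrite /gauss_tower /= hornerC expr0n oppr0 expR0 mulr1. Qed.

End towers.

(** * Integration of real functions *)

Section real_integrals.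
Context d (T : measurableType d) (R : realType).
Variable mu : {measure set T -> \bar R}.
Implicit Types (D : set T) (f g : T -> R).

Lemma integrable_le D f g : measurable D -> measurable_fun D f ->
  mu.-integrable D (EFin \o g) -> (forall x, D x -> `|f x| <= g x) ->
  mu.-integrable D (EFin \o f).
Proof.
move=> mD mf ig fg; apply: le_integrable ig => //; first exact/measurable_EFinP.
by move=> x Dx /=; rewrite lee_fin (le_trans (fg x Dx)) // ler_norm.
Qed.

Lemma integrable_EFin_measurable D f :
  mu.-integrable D (EFin \o f) -> measurable_fun D f.
Proof. by move=> /measurable_int /measurable_EFinP. Qed.

Lemma integrableRD D f g : measurable D ->
  mu.-integrable D (EFin \o f) -> mu.-integrable D (EFin \o g) ->
  mu.-integrable D (EFin \o (fun x => f x + g x)).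
Proof. by move=> mD fi gi; exact: (integrableD mD fi gi). Qed.

Lemma integrableRZ D c f : measurable D -> mu.-integrable D (EFin \o f) ->
  mu.-integrable D (EFin \o (fun x => c * f x)).
Proof. by move=> mD fi; exact: (integrableZl mD c fi). Qed.

Lemma integrableRB D f g : measurable D ->
  mu.-integrable D (EFin \o f) -> mu.-integrable D (EFin \o g) ->
  mu.-integrable D (EFin \o (fun x => f x - g x)).
Proof. by move=> mD fi gi; exact: (integrableB mD fi gi). Qed.

Lemma integrableR_norm D f : mu.-integrable D (EFin \o f) ->
  mu.-integrable D (EFin \o (fun x => `|f x|)).
Proof. by move=> fi; exact: (integrable_norm fi). Qed.

Lemma integrableR_sum D n (h : 'I_n -> T -> R) : measurable D ->
  (forall i, mu.-integrable D (EFin \o h i)) ->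
  mu.-integrable D (EFin \o (fun x => \sum_(i < n) h i x)).
Proof.
move=> mD hi; elim: n h hi => [|n IH] h hi.
  apply: (eq_integrable mD (cst 0%E)); last exact: integrable0.
  by move=> x _ /=; rewrite big_ord0.
apply: (eq_integrable mD (EFin \o
    (fun x => \sum_(i < n) h (widen_ord (leqnSn n) i) x + h ord_max x))).
  by move=> x _ /=; rewrite big_ord_recr.
apply: integrableRD => //; exact: IH.
Qed.

Lemma Rintegral_sum D n (h : 'I_n -> T -> R) : measurable D ->
  (forall i, mu.-integrable D (EFin \o h i)) ->
  \int[mu]_(x in D) (\sum_(i < n) h i x) = \sum_(i < n) \int[mu]_(x in D) h i x.
Proof.
move=> mD; elim: n h => [|n IH] h hi.
  rewrite big_ord0 -[RHS](mul0r (fine (mu D))) -Rintegral_cst //.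
  by apply: eq_Rintegral => x _; rewrite big_ord0.
rewrite big_ord_recr /= -IH // -RintegralD //; last exact: integrableR_sum.
by apply: eq_Rintegral => x _; rewrite big_ord_recr.
Qed.

Lemma dominated_cvg_Rintegral D (f_ : nat -> T -> R) f g : measurable D ->
  (forall n, measurable_fun D (f_ n)) ->
  (forall x, D x -> f_ ^~ x @ \oo --> f x) ->
  mu.-integrable D (EFin \o g) ->
  (forall n x, D x -> `|f_ n x| <= g x) ->
  mu.-integrable D (EFin \o f) /\
  \int[mu]_(x in D) f_ n x @[n --> \oo] --> \int[mu]_(x in D) f x.
Proof.
move=> mD mf_ f_f ig f_g.
have f_fE x : D x -> (fun n => (f_ n x)%:E) @ \oo --> (f x)%:E.
  by move=> Dx; apply: cvg_EFin; [exact: nearW | exact: f_f].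
have mf_E n : measurable_fun D (EFin \o f_ n) by exact/measurable_EFinP.
have mfE : measurable_fun D (EFin \o f) by exact: (emeasurable_fun_cvg _ _ mf_E).
have [fi _ c] := @dominated_convergence _ _ _ mu D mD (fun n => EFin \o f_ n)
  (EFin \o f) (EFin \o g) mf_E mfE (aeW _ f_fE) ig
  (aeW _ (fun x n Dx => f_g n x Dx)).
split=> //; apply: fine_cvg; rewrite fineK //; exact: integrable_fin_num.
Qed.

Lemma EFin_Rintegral D f : measurable D -> mu.-integrable D (EFin \o f) ->
  (\int[mu]_(x in D) f x)%:E = (\int[mu]_(x in D) (f x)%:E)%E.
Proof. by move=> mD fi; rewrite fineK //; exact: integrable_fin_num. Qed.

(** Fatou's lemma. It produces both the second moment of F and the exponential moments, as limits of
    integrals bounded uniformly. *)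
Lemma integrable_cvg_le (f_ : nat -> T -> R) f C :
  (forall n, mu.-integrable setT (EFin \o f_ n)) ->
  (forall n x, 0 <= f_ n x) ->
  (forall x, f_ ^~ x @ \oo --> f x) ->
  (forall n, \int[mu]_x f_ n x <= C) ->
  mu.-integrable setT (EFin \o f).
Proof.
move=> fi_ f_0 f_f fC.
have f_fE x : (fun n => (f_ n x)%:E) @ \oo --> (f x)%:E.
  by apply: cvg_EFin; [exact: nearW | exact: f_f].
have mf_E n : measurable_fun setT (EFin \o f_ n) by exact: measurable_int (fi_ n).
have mfE : measurable_fun setT (EFin \o f).
  by apply: (emeasurable_fun_cvg _ _ mf_E) => x _; exact: f_fE.
have f0 x : 0 <= f x.
  by apply: (cvgr_to_ge (f_f x)); exact: nearW.
apply/integrableP; split => //.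
apply: (@le_lt_trans _ _ C%:E); last exact: ltry.
have := @fatou _ _ _ mu setT measurableT (fun n => EFin \o f_ n) mf_E
  (fun n x _ => f_0 n x).
have -> : (\int[mu]_(x in setT) limn_einf ((fun n => EFin \o f_ n)^~ x) =
  \int[mu]_(x in setT) `|(EFin \o f) x|)%E.
  apply: eq_integral => x _ /=; rewrite ger0_norm //.
  by have [-> _] := cvg_limn_einf_sup (f_fE x).
move=> /le_trans; apply.
rewrite limn_einf_lim; apply: lime_le; first exact: is_cvg_einfs.
apply: nearW => n; apply: (@le_trans _ _ (\int[mu]_x (f_ n x)%:E)%E).
  by apply: ereal_inf_lbound; exists n => //=.
by rewrite -EFin_Rintegral // lee_fin.
Qed.

End real_integrals.

(** * Exchange of integrals with a bounded kernel *)

Section product_integrals.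
Context d1 d2 (T1 : measurableType d1) (T2 : measurableType d2) (R : realType).
Variable m1 : {sigma_finite_measure set T1 -> \bar R}.
Variable m2 : {sigma_finite_measure set T2 -> \bar R}.

(** The integrand is dominated by M |u(x)| |v(y)|, whose double integral factors; this is what
    Fubini's theorem needs. *)
Lemma Rintegral_swap (u : T1 -> R) (v : T2 -> R) (k : T1 * T2 -> R) M :
  m1.-integrable setT (EFin \o u) -> m2.-integrable setT (EFin \o v) ->
  measurable_fun setT k -> (forall z, `|k z| <= M) ->
  \int[m1]_x (u x * \int[m2]_y (v y * k (x, y))) =
  \int[m2]_y (v y * \int[m1]_x (u x * k (x, y))).
Proof.
move=> ui vi mk kM.
have mu := integrable_EFin_measurable ui; have mv := integrable_EFin_measurable vi.
have mkx x : measurable_fun setT (fun y => k (x, y)).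
  exact: (measurableT_comp mk (measurable_pair1 _)).
have mky y : measurable_fun setT (fun x => k (x, y)).
  exact: (measurableT_comp mk (measurable_pair2 _)).
have ivk x : m2.-integrable setT (EFin \o (fun y => v y * k (x, y))).
  apply: (@integrable_le _ _ _ _ _ _ (fun y => M * `|v y|)) => //.
  - exact: measurable_funM.
  - by apply: integrableRZ => //; exact: integrableR_norm.
  - by move=> y _; rewrite normrM mulrC ler_wpM2r.
have iuk y : m1.-integrable setT (EFin \o (fun x => u x * k (x, y))).
  apply: (@integrable_le _ _ _ _ _ _ (fun x => M * `|u x|)) => //.
  - exact: measurable_funM.
  - by apply: integrableRZ => //; exact: integrableR_norm.
  - by move=> x _; rewrite normrM mulrC ler_wpM2r.
pose F (z : T1 * T2) := ((u z.1 * v z.2 * k z)%:E : \bar R).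
have mF : measurable_fun setT F.
  apply/measurable_EFinP; apply: measurable_funM => //; apply: measurable_funM.
    exact: measurableT_comp mu measurable_fst.
  exact: measurableT_comp mv measurable_snd.
have iF : (m1 \x m2)%E.-integrable setT F.
  apply/integrable12ltyP => //.
  have M0 (x : T1) (y : T2) : 0 <= M by apply: le_trans (kM (x, y)); exact: normr_ge0.
  apply: (@le_lt_trans _ _
     (\int[m1]_x (`|u x| * \int[m2]_y (M * `|v y|))%R%:E)%E); last first.
    have : m1.-integrable setT
      (EFin \o (fun x => (\int[m2]_y (M * `|v y|)) * `|u x|)).
      by apply: integrableRZ => //; exact: integrableR_norm.
    move=> /(integrable_lty measurableT); congr (_ < _)%E.
    by apply: eq_integral => x _ /=; rewrite mulrC.
  apply: ge0_le_integral => //.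
  - by move=> x _; apply: integral_ge0.
  - apply: (@measurable_fun_fubini_tonelli_F _ _ _ _ _ m2 (abse \o F)).
      exact: measurableT_comp.
    by move=> z; exact: abse_ge0.
  - apply/measurable_EFinP; apply: measurable_funM => //; exact: measurableT_comp.
  - move=> x _.
    have iMv : m2.-integrable setT (EFin \o (fun y => M * `|v y|)).
      by apply: integrableRZ => //; exact: integrableR_norm.
    rewrite -RintegralZl // EFin_Rintegral //; last exact: integrableRZ.
    apply: ge0_le_integral => //.
    + exact/measurableT_comp/measurableT_comp.
    + by apply/measurable_EFinP; do 2 (apply: measurable_funM => //);
        exact: measurableT_comp.
    + move=> y _; rewrite /F /= lee_fin !normrM -mulrA ler_wpM2l //.
      by rewrite mulrC ler_wpM2r.
have := Fubini iF; rewrite /F /= => E.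
congr fine.
transitivity (\int[m1]_x \int[m2]_y (u x * v y * k (x, y))%:E)%E.
  apply: eq_integral => x _; rewrite -RintegralZl // EFin_Rintegral //.
    by apply: eq_integral => y _; rewrite mulrA.
  exact: integrableRZ.
rewrite E; apply: eq_integral => y _.
rewrite -[in RHS]RintegralZl // EFin_Rintegral //; last exact: integrableRZ.
by apply: eq_integral => x _; rewrite mulrA (mulrC (v y)).
Qed.

End product_integrals.

Section fundamental_theorem.
Context {R : realType}.
Notation leb := (@lebesgue_measure R).
Implicit Types G g : R -> R.

(** The fundamental theorem on intervals exhausting D, then dominated convergence with |g| as the
    bound. Every integration by parts below is an instance, with G the product whose boundary values
    have a known limit. *)
Lemma Rintegral_derivative_cvg (D : set R) (u v : nat -> R) G g l :
  measurable D -> (forall n, u n < v n) -> (forall n, `[u n, v n] `<=` D) ->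
  (forall x, D x -> \forall n \near \oo, `[u n, v n]%classic x) ->
  (forall x, is_derive x (1 : R) G (g x)) -> continuous g ->
  leb.-integrable D (EFin \o g) ->
  G (v n) - G (u n) @[n --> \oo] --> l ->
  \int[leb]_(x in D) g x = l.
Proof.
move=> mD uv uvD Duv dG cg ig Gl.
have mg := integrable_EFin_measurable ig.
have cG : continuous G by move=> x; exact: is_derive_continuous (dG x).
have E n : \int[leb]_(x in D) (g \_ `[u n, v n]) x = G (v n) - G (u n).
  rewrite -Rintegral_mkcondr setIidr //.
  rewrite /Rintegral (@continuous_FTC2 _ g G _ _ (uv n)) //=.
  - exact: continuous_subspaceT.
  - split; first by move=> x _; have [] := dG x.
    + exact: cvg_at_right_filter (cG _).
    + exact: cvg_at_left_filter (cG _).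
  - by move=> x _; rewrite derive1E; have [_ ->] := dG x.
have [] := @dominated_cvg_Rintegral _ _ _ leb D (fun n => g \_ `[u n, v n]) g
  (fun x => `|g x|) mD.
- move=> n; apply/measurable_restrict => //.
  by apply: measurable_funS mg => //; exact: subIsetl.
- move=> x Dx; apply: cvg_near_cst; apply: filterS (Duv x Dx) => n xn.
  by rewrite patchE mem_set.
- exact: integrableR_norm.
- by move=> n x _; rewrite patchE; case: ifP => // _; rewrite normr0.
move=> _ c; apply/esym; apply: (cvg_unique _ Gl) => //.
by move: c; under eq_fun do rewrite E.
Qed.

End fundamental_theorem.

Section parameter.
Context d (T : measurableType d) (R : realType).
Variable mu : {measure set T -> \bar R}.

Lemma continuous_Rintegral (v : T -> R) (k : R -> T -> R) M :
  mu.-integrable setT (EFin \o v) -> (forall x, measurable_fun setT (k x)) ->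
  (forall y, continuous (k ^~ y)) -> (forall x y, `|k x y| <= M) ->
  continuous (fun x => \int[mu]_y (v y * k x y)).
Proof.
move=> iv mk ck kM a.
have vk x y : `|v y * k x y| <= M * `|v y|.
  by rewrite normrM mulrC ler_wpM2r.
have iMv : mu.-integrable setT (EFin \o (fun y => M * `|v y|)).
  by apply: integrableRZ => //; exact: integrableR_norm.
have := @continuity_under_integral R _ T mu (fun x y => v y * k x y) setT
  measurableT (a - 1) (a + 1) _ _ (fun y => M * `|v y|) iMv _ a.
apply.
- move=> x _; apply: (integrable_le measurableT _ iMv) => //.
  by apply: measurable_funM => //; exact: integrable_EFin_measurable iv.
- apply: aeW => y _ x _; apply: cvgM; [exact: cvg_cst | exact: ck].
- by move=> x _; apply: aeW => y _; exact: vk.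
- by rewrite inE /= in_itv /= ltrBlDr ltrDl ltr01.
Qed.

End parameter.

(** * Exponential damping of the cosine *)

Section exponential_cosine_transform.
Context {R : realType}.

Lemma cvg0_le (u v : nat -> R) :
  (forall n, `|u n| <= v n) -> v @ \oo --> 0 -> u @ \oo --> 0.
Proof.
move=> uv v0; apply: norm_cvg0; apply: (squeeze_cvgr _ (cvg_cst 0) v0).
by apply: nearW => n; rewrite normr_ge0 uv.
Qed.

Notation leb := (@lebesgue_measure R).

Lemma measurable_cos : measurable_fun setT (@cos R).
Proof. by apply: continuous_measurable_fun; exact: continuous_cos. Qed.

Lemma measurable_sin : measurable_fun setT (@sin R).
Proof. by apply: continuous_measurable_fun; exact: continuous_sin. Qed.

Lemma normr_cos_le1 (x : R) : `|cos x| <= 1.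
Proof. by rewrite ler_norml cos_geN1 cos_le1. Qed.

Lemma normr_sin_le1 (x : R) : `|sin x| <= 1.
Proof. by rewrite ler_norml sin_geN1 sin_le1. Qed.

(** Damping the frequencies by e exp (- e xi) on xi >= 0 creates e times the Poisson kernel (without
    the factor 1 / pi). *)
Lemma Rintegral_exponential_cos (e u : R) : 0 < e ->
  \int[leb]_xi (exponential_pdf e xi * cos (xi * u)) = e ^+ 2 / (e ^+ 2 + u ^+ 2).
Proof.
move=> e0.
have eu : e ^+ 2 + u ^+ 2 != 0.
  by rewrite gt_eqF // ltr_wpDr ?sqr_ge0 // exprn_gt0.
have iE : leb.-integrable `[0, +oo[ (EFin \o (fun x : R => e * expR (- e * x))).
  apply/integrable_mkcond; first exact: measurable_itv.
  by rewrite restrict_EFin; exact: (integrable_exponential_pdf e0).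
have -> : (fun xi => exponential_pdf e xi * cos (xi * u)) =
    ((fun xi => e * expR (- e * xi) * cos (xi * u)) \_ `[0, +oo[).
  apply/funext => x; rewrite /exponential_pdf /= !patchE.
  by case: ifP => // _; rewrite mul0r.
rewrite -Rintegral_mkcond.
pose c := e / (e ^+ 2 + u ^+ 2).
(* An explicit primitive of e exp (- e x) cos (x u), found by integrating by parts twice. *)
pose G x := c * (expR (- e * x) * (u * sin (x * u) - e * cos (x * u))).
have G0 : G 0 = - (e ^+ 2 / (e ^+ 2 + u ^+ 2)).
  by rewrite /G /c !(mulr0, mul0r) expR0 sin0 cos0; field.
apply: (@Rintegral_derivative_cvg _ _ (fun _ => 0) (fun n => n.+1%:R) G).
- exact: measurable_itv.
- by move=> n; rewrite ltr0n.
- by move=> n; exact: subset_itvl.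
- move=> x /=; rewrite in_itv /= andbT => x0.
  have [N _ HN] := nbhs_infty_ger (x : R).
  exists N => // k /= Nk; rewrite in_itv /= x0 /=.
  by apply: le_trans (HN k Nk) _; rewrite ler_nat.
- move=> x.
  have du := is_derive1M (is_derive_id x (1 : R)) (is_derive_cst u x (1 : R)).
  have de := is_derive1Z (- e) (is_derive_id x (1 : R)).
  have h := is_derive1Z c (is_derive1M
    (is_derive1_compose (x := x) (is_derive_expR _) de)
    (is_derive1D (is_derive1Z u (is_derive1_compose (x := x) (is_derive_sin _) du))
     (is_derive1N (is_derive1Z e (is_derive1_compose (x := x) (is_derive_cos _) du))))).
  apply: (is_derive_eq h); rewrite /c /=; field.
  by [].
- move=> x; apply: cvgM.
    apply: cvgM; [exact: cvg_cst | ].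
    by apply: continuous_comp; [exact: mulrl_continuous | exact: continuous_expR].
  by apply: continuous_comp; [exact: mulrr_continuous | exact: continuous_cos].
- apply: (integrable_le _ _ iE).
  + exact: measurable_itv.
  + apply: measurable_funM.
      exact: integrable_EFin_measurable iE.
    apply: measurable_funTS; apply: measurableT_comp; first exact: measurable_cos.
    by apply: measurable_funM => //; exact: measurable_cst.
  + move=> x _; rewrite normrM (ger0_norm (x := e * _)); last first.
      by rewrite mulr_ge0 ?expR_ge0 // ltW.
    by rewrite ler_piMr ?normr_cos_le1 // mulr_ge0 ?expR_ge0 // ltW.
- rewrite G0 opprK -[X in _ --> X]add0r; apply: cvgD; last exact: cvg_cst.
  have -> : (fun n => G n.+1%:R) = (fun n => expR (- e) ^+ n.+1 *
      (c * (u * sin (n.+1%:R * u) - e * cos (n.+1%:R * u)))).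
    by apply/funext => n; rewrite /G -expRM_natl (mulrC (n.+1%:R) (- e)); ring.
  have E1 : `|expR (- e)| < 1.
    by rewrite ger0_norm ?expR_ge0 // -expR0 ltr_expR oppr_lt0.
  have h := cvg_expr E1.
  have h2 : (fun n => `|c| * (`|u| + e) * `|expR (- e)| ^+ n.+1) @ \oo --> 0.
    rewrite -[X in _ --> X](mulr0 (`|c| * (`|u| + e))).
    apply: cvgM; first exact: cvg_cst.
    by rewrite (cvg_shiftS (fun n => `|expR (- e)| ^+ n)); apply: cvg_expr; rewrite normr_id.
  apply: (cvg0_le _ h2) => n; rewrite !normrM normrX mulrC.
  rewrite ler_wpM2r ?exprn_ge0 // ler_wpM2l //.
  apply: le_trans (ler_normB _ _) _; apply: lerD; rewrite normrM.
    by rewrite ler_piMr // normr_sin_le1.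
  by rewrite (gtr0_norm e0) ler_piMr ?normr_cos_le1 // ltW.
Qed.

End exponential_cosine_transform.

Section trigonometric_integrals.
Context d (T : measurableType d) (R : realType).
Variables (mu : {measure set T -> \bar R}) (w v : T -> R).
Hypothesis iw : mu.-integrable setT (EFin \o w).
Hypothesis mv : measurable_fun setT v.

Let mxi (xi : R) : measurable_fun setT (fun x => xi * v x).
Proof. exact: measurable_funM. Qed.

Lemma integrable_mulr_cos xi :
  mu.-integrable setT (EFin \o (fun x => w x * cos (xi * v x))).
Proof.
have mw := integrable_EFin_measurable iw.
apply: (integrable_le _ _ (integrableR_norm iw)) => //.
  by apply: measurable_funM => //; exact: measurableT_comp measurable_cos (mxi _).
by move=> x _; rewrite normrM ler_piMr // normr_cos_le1.
Qed.

Lemma integrable_mulr_sin xi :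
  mu.-integrable setT (EFin \o (fun x => w x * sin (xi * v x))).
Proof.
have mw := integrable_EFin_measurable iw.
apply: (integrable_le _ _ (integrableR_norm iw)) => //.
  by apply: measurable_funM => //; exact: measurableT_comp measurable_sin (mxi _).
by move=> x _; rewrite normrM ler_piMr // normr_sin_le1.
Qed.

Lemma continuous_cos_integral : continuous (fun xi : R => \int[mu]_x (w x * cos (xi * v x))).
Proof.
apply: (@continuous_Rintegral _ _ _ mu w (fun xi x => cos (xi * v x)) 1) => //.
- by move=> xi; exact: measurableT_comp measurable_cos (mxi _).
- by move=> x xi; apply: continuous_comp; [exact: mulrr_continuous | exact: continuous_cos].
- by move=> x t; exact: normr_cos_le1.
Qed.

Lemma continuous_sin_integral : continuous (fun xi : R => \int[mu]_x (w x * sin (xi * v x))).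
Proof.
apply: (@continuous_Rintegral _ _ _ mu w (fun xi x => sin (xi * v x)) 1) => //.
- by move=> xi; exact: measurableT_comp measurable_sin (mxi _).
- by move=> x xi; apply: continuous_comp; [exact: mulrr_continuous | exact: continuous_sin].
- by move=> x t; exact: normr_sin_le1.
Qed.

Lemma normr_cos_integral_le xi :
  `|\int[mu]_x (w x * cos (xi * v x))| <= \int[mu]_x `|w x|.
Proof.
have h := integrable_mulr_cos xi.
apply: le_trans (le_normr_Rintegral _ h) _ => //; apply: le_Rintegral => //.
- exact: integrableR_norm h.
- exact: integrableR_norm.
- by move=> x _; rewrite normrM ler_piMr // normr_cos_le1.
Qed.

Lemma normr_sin_integral_le xi :
  `|\int[mu]_x (w x * sin (xi * v x))| <= \int[mu]_x `|w x|.
Proof.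
have h := integrable_mulr_sin xi.
apply: le_trans (le_normr_Rintegral _ h) _ => //; apply: le_Rintegral => //.
- exact: integrableR_norm h.
- exact: integrableR_norm.
- by move=> x _; rewrite normrM ler_piMr // normr_sin_le1.
Qed.

End trigonometric_integrals.
Arguments integrable_mulr_cos [d T R] mu [w] v.
Arguments integrable_mulr_sin [d T R] mu [w] v.
Arguments continuous_cos_integral [d T R] mu [w] v.
Arguments continuous_sin_integral [d T R] mu [w] v.
Arguments normr_cos_integral_le [d T R] mu [w] v.
Arguments normr_sin_integral_le [d T R] mu [w] v.

(** * Fourier inversion *)

Section inversion_formula.
Context {R : realType}.
Notation leb := (@lebesgue_measure R).

(** Follows from m <= |x| + |y| and |y| <= 1 + y^2. A decay in 1 / m is enough to kill the boundary
    terms. *)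
Lemma invr_oneDsqr_shift_le (x y m : R) : 0 < m -> `|y - x| = m ->
  (1 + y ^+ 2)^-1 <= (`|x| + 1) * m^-1.
Proof.
move=> m0 ym.
have y2 : 0 < 1 + y ^+ 2 by rewrite ltr_pwDl // sqr_ge0.
rewrite -[X in X <= _]mul1r ler_pdivrMr // mulrAC ler_pdivlMr // mul1r.
rewrite -ym; apply: le_trans (ler_normB _ _) _.
have h : `|y| <= 1 + y ^+ 2.
  rewrite -(real_normK (num_real y)); have := sqr_ge0 (`|y| - 1); have := normr_ge0 y.
  by nra.
have := normr_ge0 x; have := sqr_ge0 y; by nra.
Qed.

Lemma integrable_oneDsqrV : leb.-integrable setT (EFin \o (fun t : R => (1 + t ^+ 2)^-1)).
Proof.
have c1 : continuous (fun t : R => (1 + t ^+ 2)^-1) by exact: continuous_oneDsqrV.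
have p1 (t : R) : 0 < (1 + t ^+ 2)^-1 by rewrite invr_gt0 ltr_pwDl // sqr_ge0.
apply/integrableP; split.
  by apply/measurable_EFinP; exact: continuous_measurable_fun.
rewrite (_ : \int[leb]_x _ = \int[leb]_x ((1 + x ^+ 2)^-1)%:E)%E; last first.
  by apply: eq_integral => x _ /=; rewrite ger0_norm // ltW.
rewrite ge0_symfun_integralT //.
- have := @integral0y_oneDsqr R; rewrite set_itvcy => ->.
  by rewrite -EFinM ltry.
- by move=> x; exact: ltW.
- by move=> x /=; rewrite sqrrN.
Qed.

Variables (g g' : R -> R) (C : R).
Hypothesis dg : forall x, is_derive x (1 : R) g (g' x).
Hypothesis cg' : continuous g'.
Hypothesis gC : forall t, `|g t| <= C * (1 + t ^+ 2)^-1.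
Hypothesis g'C : forall t, `|g' t| <= C * (1 + t ^+ 2)^-1.

Let cg : continuous g.
Proof. by move=> x; exact: is_derive_continuous (dg x). Qed.

Let mg : measurable_fun setT g.
Proof. exact: continuous_measurable_fun. Qed.

Let mg' : measurable_fun setT g'.
Proof. exact: continuous_measurable_fun. Qed.

Let iC : leb.-integrable setT (EFin \o (fun t : R => C * (1 + t ^+ 2)^-1)).
Proof. by apply: integrableRZ => //; exact: integrable_oneDsqrV. Qed.

Let C0 : 0 <= C.
Proof. by have := gC 0; rewrite expr0n addr0 invr1 mulr1; apply: le_trans. Qed.

Lemma decay_integrable : leb.-integrable setT (EFin \o g).
Proof. by apply: (integrable_le _ _ iC). Qed.

Lemma decay_derivative_integrable : leb.-integrable setT (EFin \o g').
Proof. by apply: (integrable_le _ _ iC). Qed.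

Lemma decay_cvg (x s : R) : `|s| = 1 -> g (x + s * n.+1%:R) @[n --> \oo] --> 0.
Proof.
move=> s1; apply: (@cvg0_le _ _ (fun n => C * (`|x| + 1) * n.+1%:R^-1)).
  move=> n; apply: le_trans (gC _) _; rewrite -mulrA ler_wpM2l //.
  apply: invr_oneDsqr_shift_le; first by rewrite ltr0n.
  by rewrite addrAC subrr add0r normrM s1 mul1r ger0_norm.
rewrite -[X in _ --> X](mulr0 (C * (`|x| + 1))).
by apply: cvgM; [exact: cvg_cst | exact: cvg_harmonic].
Qed.

Lemma Rintegral_right (x : R) : \int[leb]_(t in `]x, +oo[) g' t = - g x.
Proof.
have ig' := decay_derivative_integrable.
rewrite Rintegral_itv_obnd_cbnd; last first.
  by apply: integrableS ig' => //; exact: measurable_itv.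
apply: (@Rintegral_derivative_cvg _ _ (fun _ => x) (fun n => x + n.+1%:R) g) => //.
- by move=> n; rewrite ltrDl ltr0n.
- by move=> n; exact: subset_itvl.
- move=> t /=; rewrite in_itv /= andbT => xt.
  have [N _ HN] := nbhs_infty_ger (t - x : R).
  exists N => // k /= Nk; rewrite in_itv /= xt /= -lerBlDl.
  by apply: le_trans (HN k Nk) _; rewrite ler_nat.
- by apply: integrableS ig' => //; exact: measurable_itv.
- rewrite -[X in _ --> X]add0r; apply: cvgD; last exact: cvg_cst.
  by have := @decay_cvg x 1 (normr1 _); under eq_fun do rewrite mul1r.
Qed.

Lemma Rintegral_left (x : R) : \int[leb]_(t in `]-oo, x]) g' t = g x.
Proof.
have ig' := decay_derivative_integrable.
apply: (@Rintegral_derivative_cvg _ _ (fun n => x - n.+1%:R) (fun _ => x) g) => //.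
- by move=> n; rewrite ltrBlDr ltrDl ltr0n.
- by move=> n; exact: subset_itvr.
- move=> t /=; rewrite in_itv /= => xt.
  have [N _ HN] := nbhs_infty_ger (x - t : R).
  exists N => // k /= Nk; rewrite in_itv /= xt andbT lerBlDr -lerBlDl.
  by apply: le_trans (HN k Nk) _; rewrite ler_nat.
- by apply: integrableS ig' => //; exact: measurable_itv.
- rewrite -[X in _ --> X]subr0; apply: cvgB; first exact: cvg_cst.
  have := @decay_cvg x (-1) _; under eq_fun do rewrite mulN1r.
  by apply; rewrite normrN normr1.
Qed.

Lemma normr_atan_le (x : R) : `|atan x| <= pi / 2.
Proof. by rewrite ler_norml (ltW (atan_gtNpi2 x)) (ltW (atan_ltpi2 x)). Qed.

Lemma measurable_atan : measurable_fun setT (@atan R).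
Proof. by apply: continuous_measurable_fun => x; exact: continuous_atan. Qed.

(** Integration by parts: the kernel is e times the derivative in t of atan ((t - x) / e). The
    kernel concentrates as e tends to 0, whereas the arctangent stays bounded, so that the limit
    becomes a matter of dominated convergence. *)
Lemma Rintegral_poisson_kernel (x e : R) : 0 < e ->
  \int[leb]_t (g t * (e ^+ 2 / (e ^+ 2 + (t - x) ^+ 2))) =
  - e * \int[leb]_t (g' t * atan ((t - x) / e)).
Proof.
move=> e0.
have den t : 0 < e ^+ 2 + (t - x) ^+ 2 by rewrite ltr_wpDr ?sqr_ge0 // exprn_gt0.
have cden : continuous (fun t => e ^+ 2 / (e ^+ 2 + (t - x) ^+ 2)).
  move=> t; apply: cvgM; first exact: cvg_cst.
  apply: cvgV; first by rewrite gt_eqF.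
  apply: cvgD; first exact: cvg_cst.
  by apply: cvgM; apply: cvgB => //; exact: cvg_cst.
have cat : continuous (fun t => atan ((t - x) / e)).
  move=> t; apply: continuous_comp; last exact: continuous_atan.
  by apply: cvgM; [apply: cvgB => //; exact: cvg_cst | exact: cvg_cst].
have i1 : leb.-integrable setT
    (EFin \o (fun t => g t * (e ^+ 2 / (e ^+ 2 + (t - x) ^+ 2)))).
  apply: (integrable_le _ _ (integrableR_norm decay_integrable)) => //.
    by apply: measurable_funM => //; exact: continuous_measurable_fun.
  move=> t _; rewrite normrM ler_piMr // ger0_norm.
    by rewrite ler_pdivrMr // mul1r lerDl sqr_ge0.
  by rewrite divr_ge0 ?sqr_ge0 // ltW.
have i2 : leb.-integrable setT (EFin \o (fun t => g' t * atan ((t - x) / e))).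
  apply: (integrable_le _ _ (integrableRZ (pi / 2) _
    (integrableR_norm decay_derivative_integrable))) => //.
    by apply: measurable_funM => //; exact: continuous_measurable_fun.
  by move=> t _; rewrite normrM mulrC ler_wpM2r // normr_atan_le.
apply/eqP; rewrite mulNr -subr_eq0 opprK -RintegralZl // -RintegralD //; last first.
  exact: integrableRZ.
apply/eqP.
apply: (@Rintegral_derivative_cvg _ _ (fun n => - n.+1%:R) (fun n => n.+1%:R)
  (fun t => e * (g t * atan ((t - x) / e)))) => //.
- by move=> n; rewrite gtrN // ltr0n.
- move=> t _.
  have [N _ HN] := nbhs_infty_ger (`|t| : R).
  exists N => // k /= Nk; rewrite in_itv /= -ler_norml.
  by apply: le_trans (HN k Nk) _; rewrite ler_nat.
- move=> t.
  have dt := is_derive1M (is_derive1D (is_derive_id t (1 : R)) (is_derive_cst (- x) t (1 : R)))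
     (is_derive_cst e^-1 t (1 : R)).
  have h := is_derive1Z e (is_derive1M (dg t)
    (is_derive1_compose (x := t) (is_derive1_atan _) dt)).
  apply: (is_derive_eq h) => /=; field.
  by rewrite !gt_eqF.
- move=> t; apply: cvgD; first by apply: cvgM; [exact: cg | exact: cden].
  by apply: cvgM; [exact: cvg_cst | apply: cvgM; [exact: cg' | exact: cat]].
- by apply: integrableRD => //; exact: integrableRZ.
- apply: (@cvg0_le _ _ (fun n => e * (pi / 2) * (C * n.+1%:R^-1 + C * n.+1%:R^-1))).
    move=> n; apply: le_trans (ler_normB _ _) _; rewrite mulrDr; apply: lerD.
      rewrite !normrM (gtr0_norm e0) -mulrA (ler_wpM2l (ltW e0)) // mulrC.
      apply: ler_pM => //; first exact: normr_atan_le.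
      apply: le_trans (gC _) _; rewrite ler_wpM2l //.
      have := @invr_oneDsqr_shift_le 0 n.+1%:R n.+1%:R.
      by rewrite normr0 add0r mul1r; apply; [rewrite ltr0n | rewrite subr0 ger0_norm].
    rewrite !normrM (gtr0_norm e0) -mulrA (ler_wpM2l (ltW e0)) // mulrC.
    apply: ler_pM => //; first exact: normr_atan_le.
    apply: le_trans (gC _) _; rewrite ler_wpM2l //.
    have := @invr_oneDsqr_shift_le 0 (- n.+1%:R) n.+1%:R.
    by rewrite normr0 add0r mul1r; apply; [rewrite ltr0n | rewrite subr0 normrN ger0_norm].
  rewrite -[X in _ --> X](mulr0 (e * (pi / 2))); apply: cvgM; first exact: cvg_cst.
  rewrite -[X in _ --> X](addr0 (0 : R)) -[X in _ --> X + X](mulr0 C).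
  by apply: cvgD; apply: cvgM; first [exact: cvg_cst | exact: cvg_harmonic].
Qed.

End inversion_formula.

(** * Inversion as the limit of Poisson kernels *)

Section inversion_limit.
Context {R : realType}.
Notation leb := (@lebesgue_measure R).
Variables (g g' : R -> R) (C : R).
Hypothesis dg : forall x, is_derive x (1 : R) g (g' x).
Hypothesis cg' : continuous g'.
Hypothesis gC : forall t, `|g t| <= C * (1 + t ^+ 2)^-1.
Hypothesis g'C : forall t, `|g' t| <= C * (1 + t ^+ 2)^-1.

Let ig := decay_integrable dg gC.
Let ig' := decay_derivative_integrable cg' g'C.

Lemma atan_scale_cvg (a : R) :
  atan (a / n.+1%:R^-1) @[n --> \oo] --> pi / 2 * Num.sg a.
Proof.
have pos (b : R) : 0 < b -> atan (b / n.+1%:R^-1) @[n --> \oo] --> pi / 2.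
  move=> b0; apply: cvg_comp; last exact: cvgy_atan.
  apply/cvgryPge => A.
  have [N _ HN] := nbhs_infty_ger (A / b : R).
  exists N => // k /= Nk; rewrite invrK mulrC -ler_pdivrMr //.
  by apply: le_trans (HN k Nk) _; rewrite ler_nat.
have [a0|a0|->] := ltgtP a 0; last 2 first.
- by rewrite gtr0_sg // mulr1; exact: pos.
- by rewrite sgr0 mulr0; under eq_fun do rewrite mul0r atan0; exact: cvg_cst.
- rewrite ltr0_sg // mulrN1.
  have Na0 : 0 < - a by rewrite oppr_gt0.
  have -> : (fun n => atan (a / n.+1%:R^-1)) = - (fun n => atan (- a / n.+1%:R^-1)).
    apply/funext => n; transitivity (- atan (- a / n.+1%:R^-1)) => //.
    by rewrite mulNr atanN opprK.
  exact: cvgN (pos _ Na0).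
Qed.

(** The half-lines on the two sides of x contribute - (pi / 2) g(x) each. The constant of the
    inversion is pi and not 2 pi because only positive frequencies are integrated. *)
Lemma Rintegral_sg (x : R) : \int[leb]_t (g' t * (pi / 2 * Num.sg (t - x))) = - pi * g x.
Proof.
(* Integrability is inherited from the arctangents, of which the sign is the pointwise limit. *)
have ih : leb.-integrable setT (EFin \o (fun t => g' t * (pi / 2 * Num.sg (t - x)))).
  have [] := @dominated_cvg_Rintegral _ _ _ leb setT
     (fun n t => g' t * atan ((t - x) / n.+1%:R^-1))
     (fun t => g' t * (pi / 2 * Num.sg (t - x))) (fun t => (pi / 2) * `|g' t|) => //.
  - move=> n; apply: measurable_funM; first exact: integrable_EFin_measurable ig'.
    apply: measurableT_comp; first exact: measurable_atan.
    by apply: measurable_funM => //; exact: measurable_funB.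
  - by move=> t _; apply: cvgM; [exact: cvg_cst | exact: atan_scale_cvg].
  - by apply: integrableRZ => //; exact: integrableR_norm.
  - by move=> n t _; rewrite normrM mulrC ler_wpM2r // normr_atan_le.
have iS (D : set R) : measurable D ->
    leb.-integrable D (EFin \o (fun t => g' t * (pi / 2 * Num.sg (t - x)))).
  by move=> mD; apply: (integrableS _ _ _ ih).
rewrite -(setUv `]-oo, x[%classic) setCitvl Rintegral_setU //=; first last.
- rewrite disj_set2E; apply/eqP; rewrite -subset0 => t [] /=; rewrite !in_itv /= andbT.
  by move=> tx; rewrite leNgt tx.
- by rewrite -setCitvl setUv; exact: ih.
have -> : \int[leb]_(t in `]-oo, x[) (g' t * (pi / 2 * Num.sg (t - x))) = - (pi / 2) * g x.
  rewrite -(Rintegral_left dg cg' gC g'C) -Rintegral_itv_bndo_bndc; last first.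
    by apply: integrableS ig' => //; exact: measurable_itv.
  rewrite -RintegralZl; [|exact: measurable_itv|]; last first.
    by apply: integrableS ig' => //; exact: measurable_itv.
  apply: eq_Rintegral => t; rewrite inE /= in_itv /= => tx.
  by rewrite ltr0_sg ?subr_lt0 //; ring.
have -> : \int[leb]_(t in `[x, +oo[) (g' t * (pi / 2 * Num.sg (t - x))) = (pi / 2) * - g x.
  rewrite -(Rintegral_right dg cg' gC g'C) -Rintegral_itv_obnd_cbnd; last first.
    by apply: iS; exact: measurable_itv.
  rewrite -RintegralZl; [|exact: measurable_itv|]; last first.
    by apply: integrableS ig' => //; exact: measurable_itv.
  apply: eq_Rintegral => t; rewrite inE /= in_itv /= andbT => tx.
  by rewrite gtr0_sg ?subr_gt0 //; ring.
by field.
Qed.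

Definition cos_transform (h : R -> R) xi := \int[leb]_t (h t * cos (xi * t)).
Definition sin_transform (h : R -> R) xi := \int[leb]_t (h t * sin (xi * t)).

Lemma fourier_kernelE xi x :
  cos_transform g xi * cos (xi * x) + sin_transform g xi * sin (xi * x) =
  \int[leb]_t (g t * cos (xi * (t - x))).
Proof.
have ic := integrable_mulr_cos leb id ig (@measurable_id _ _ _) xi.
have isn := integrable_mulr_sin leb id ig (@measurable_id _ _ _) xi.
rewrite ![_ * cos (xi * x)]mulrC ![_ * sin (xi * x)]mulrC.
rewrite -!RintegralZl // -RintegralD //; [|exact: integrableRZ..].
apply: eq_Rintegral => t _; rewrite mulrBr cosB; ring.
Qed.

Lemma fourier_inversion_integrable (mu : probability R R) (w : R -> R) n :
  mu.-integrable setT (EFin \o w) ->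
  leb.-integrable setT (EFin \o (fun xi => exponential_pdf n.+1%:R^-1 xi *
     (cos_transform g xi * \int[mu]_x (w x * cos (xi * x)) +
      sin_transform g xi * \int[mu]_x (w x * sin (xi * x))))).
Proof.
move=> iw.
have ie : leb.-integrable setT (EFin \o (exponential_pdf (n.+1%:R^-1 : R))).
  by apply: integrable_exponential_pdf; rewrite invr_gt0 ltr0n.
pose M := (\int[leb]_t `|g t| * \int[mu]_x `|w x|).
apply: (integrable_le _ _ (integrableRZ (M + M) _ (integrableR_norm ie))) => //.
  apply: measurable_funM; first exact: integrable_EFin_measurable ie.
  apply: continuous_measurable_fun => xi; apply: cvgD; apply: cvgM.
  - exact: (continuous_cos_integral leb id ig (@measurable_id _ _ _)).
  - exact: (continuous_cos_integral mu id iw (@measurable_id _ _ _)).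
  - exact: (continuous_sin_integral leb id ig (@measurable_id _ _ _)).
  - exact: (continuous_sin_integral mu id iw (@measurable_id _ _ _)).
move=> xi _; rewrite normrM mulrC ler_wpM2r //.
apply: le_trans (ler_normD _ _) _; apply: lerD; rewrite normrM; apply: ler_pM => //.
- exact: (normr_cos_integral_le leb id ig (@measurable_id _ _ _)).
- exact: (normr_cos_integral_le mu id iw (@measurable_id _ _ _)).
- exact: (normr_sin_integral_le leb id ig (@measurable_id _ _ _)).
- exact: (normr_sin_integral_le mu id iw (@measurable_id _ _ _)).
Qed.

(** Inversion is integrated against w mu from the start, which is the form needed for the terms of a
    Stein identity. The factor n + 1 undoes the normalisation e of the exponential density, leaving
    the bare damping exp (- e xi) with e = 1 / (n + 1). *)
Lemma fourier_inversion (mu : probability R R) (w : R -> R) :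
  mu.-integrable setT (EFin \o w) ->
  (fun n => n.+1%:R * \int[leb]_xi (exponential_pdf n.+1%:R^-1 xi *
     (cos_transform g xi * \int[mu]_x (w x * cos (xi * x)) +
      sin_transform g xi * \int[mu]_x (w x * sin (xi * x))))) @ \oo -->
  pi * \int[mu]_x (w x * g x).
Proof.
move=> iw.
have mw := integrable_EFin_measurable iw.
have mg := integrable_EFin_measurable ig.
have mg' := integrable_EFin_measurable ig'.
pose J n x := \int[leb]_t (g' t * atan ((t - x) / n.+1%:R^-1)).
have cJ n : continuous (J n).
  apply: (@continuous_Rintegral _ _ _ leb g' (fun x t => atan ((t - x) / n.+1%:R^-1)) (pi / 2)) => //.
  - move=> x; apply: measurableT_comp; first exact: measurable_atan.
    by apply: measurable_funM => //; exact: measurable_funB.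
  - move=> t x; apply: continuous_comp; last exact: continuous_atan.
    by apply: cvgM; [apply: cvgB => //; exact: cvg_cst | exact: cvg_cst].
  - by move=> x t; exact: normr_atan_le.
have cC : continuous (cos_transform g) by exact: (continuous_cos_integral leb id ig (@measurable_id _ _ _)).
have cS : continuous (sin_transform g) by exact: (continuous_sin_integral leb id ig (@measurable_id _ _ _)).
have me n : leb.-integrable setT (EFin \o (exponential_pdf (n.+1%:R^-1 : R))).
  by apply: integrable_exponential_pdf; rewrite invr_gt0 ltr0n.
have mxy : measurable_fun setT (fun z : R * R => z.1 * z.2) by exact: measurable_funM.
have mcxy : measurable_fun setT (fun z : R * R => cos (z.1 * z.2)).
  exact: measurableT_comp measurable_cos mxy.
have msxy : measurable_fun setT (fun z : R * R => sin (z.1 * z.2)).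
  exact: measurableT_comp measurable_sin mxy.
have JM n x : `|J n x| <= pi / 2 * \int[leb]_t `|g' t|.
  have i1 : leb.-integrable setT (EFin \o (fun t => g' t * atan ((t - x) / n.+1%:R^-1))).
    apply: (integrable_le _ _ (integrableRZ (pi / 2) _ (integrableR_norm ig'))) => //.
      apply: measurable_funM => //; apply: measurableT_comp; first exact: measurable_atan.
      by apply: measurable_funM => //; exact: measurable_funB.
    by move=> t _; rewrite normrM mulrC ler_wpM2r // normr_atan_le.
  apply: le_trans (le_normr_Rintegral _ i1) _ => //; rewrite -RintegralZl //; last first.
    exact: integrableR_norm.
  apply: le_Rintegral => //.
  - exact: integrableR_norm.
  - by apply: integrableRZ => //; exact: integrableR_norm.
  - by move=> t _; rewrite normrM mulrC ler_wpM2r // normr_atan_le.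
have iwJ n : mu.-integrable setT (EFin \o (fun x => w x * J n x)).
  apply: (integrable_le _ _ (integrableRZ (pi / 2 * \int[leb]_t `|g' t|) _
    (integrableR_norm iw))) => //.
    by apply: measurable_funM => //; exact: continuous_measurable_fun.
  by move=> x _; rewrite normrM mulrC ler_wpM2r.
have E n : n.+1%:R * \int[leb]_xi (exponential_pdf n.+1%:R^-1 xi *
     (cos_transform g xi * \int[mu]_x (w x * cos (xi * x)) +
      sin_transform g xi * \int[mu]_x (w x * sin (xi * x)))) =
    - \int[mu]_x (w x * J n x).
  pose e := (n.+1%:R^-1 : R).
  have e0 : 0 < e by rewrite invr_gt0 ltr0n.
  pose k (z : R * R) := cos_transform g z.1 * cos (z.1 * z.2) +
                        sin_transform g z.1 * sin (z.1 * z.2).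
  have mk : measurable_fun setT k.
    apply: measurable_funD; apply: measurable_funM => //.
      by apply: measurableT_comp => //; exact: continuous_measurable_fun.
    by apply: measurableT_comp => //; exact: continuous_measurable_fun.
  have kM z : `|k z| <= \int[leb]_t `|g t| + \int[leb]_t `|g t|.
    apply: le_trans (ler_normD _ _) _; apply: lerD; rewrite normrM -[leRHS]mulr1.
      apply: ler_pM => //; last exact: normr_cos_le1.
      exact: (normr_cos_integral_le leb id ig (@measurable_id _ _ _)).
    apply: ler_pM => //; last exact: normr_sin_le1.
    exact: (normr_sin_integral_le leb id ig (@measurable_id _ _ _)).
  transitivity (n.+1%:R * \int[leb]_xi (exponential_pdf e xi * \int[mu]_x (w x * k (xi, x)))).
    congr (_ * _); apply: eq_Rintegral => xi _; congr (_ * _).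
    have wc := integrable_mulr_cos mu id iw (@measurable_id _ _ _) xi.
    have ws := integrable_mulr_sin mu id iw (@measurable_id _ _ _) xi.
    rewrite -!RintegralZl // -RintegralD //; [|exact: integrableRZ..].
    by apply: eq_Rintegral => x _; rewrite /k /=; ring.
  (* Exchanging xi and t makes the Poisson kernel appear; the exchange of xi and x comes right
     after. *)
  have Hx x : \int[leb]_xi (exponential_pdf e xi * k (xi, x)) = - e * J n x.
    transitivity (\int[leb]_xi (exponential_pdf e xi * \int[leb]_t (g t * cos (xi * (t - x))))).
      by apply: eq_Rintegral => xi _; rewrite -fourier_kernelE.
    rewrite (@Rintegral_swap _ _ _ _ _ leb leb (exponential_pdf e) g
       (fun z => cos (z.1 * (z.2 - x))) 1 (me n) ig).
    - rewrite -(Rintegral_poisson_kernel dg cg' gC g'C x e0).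
      by apply: eq_Rintegral => t _ /=; rewrite Rintegral_exponential_cos.
    - apply: measurableT_comp; first exact: measurable_cos.
      by apply: measurable_funM => //; exact: measurable_funB.
    - by move=> z; exact: normr_cos_le1.
  rewrite (Rintegral_swap (me n) iw mk kM).
  transitivity (n.+1%:R * \int[mu]_x (- e * (w x * J n x))).
    by congr (_ * _); apply: eq_Rintegral => x _; rewrite Hx; ring.
  by rewrite RintegralZl // /e mulNr mulrN mulrA divff ?mul1r // pnatr_eq0.
under eq_fun do rewrite E.
have Jg x : J n x @[n --> \oo] --> - pi * g x.
  rewrite -Rintegral_sg.
  have [] := @dominated_cvg_Rintegral _ _ _ leb setT
     (fun n t => g' t * atan ((t - x) / n.+1%:R^-1))
     (fun t => g' t * (pi / 2 * Num.sg (t - x))) (fun t => (pi / 2) * `|g' t|) => //.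
  - move=> n; apply: measurable_funM => //.
    apply: measurableT_comp; first exact: measurable_atan.
    by apply: measurable_funM => //; exact: measurable_funB.
  - by move=> t _; apply: cvgM; [exact: cvg_cst | exact: atan_scale_cvg].
  - by apply: integrableRZ => //; exact: integrableR_norm.
  - by move=> n t _; rewrite normrM mulrC ler_wpM2r // normr_atan_le.
have [iwg L] := @dominated_cvg_Rintegral _ _ _ mu setT
     (fun n x => w x * J n x) (fun x => w x * (- pi * g x))
     (fun x => (pi / 2 * \int[leb]_t `|g' t|) * `|w x|) measurableT
     (fun n => integrable_EFin_measurable (iwJ n))
     (fun x _ => cvgM (cvg_cst (w x)) (Jg x))
     (integrableRZ _ measurableT (integrableR_norm iw))
     (fun n x _ => ltac:(by rewrite normrM mulrC ler_wpM2r)).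
have C0 : 0 <= C by have := gC 0; rewrite expr0n addr0 invr1 mulr1; apply: le_trans.
have iwg' : mu.-integrable setT (EFin \o (fun x => w x * g x)).
  apply: (integrable_le _ _ (integrableRZ C _ (integrableR_norm iw))) => //.
    by apply: measurable_funM.
  move=> x _; rewrite normrM mulrC ler_wpM2r // (le_trans (gC x)) //.
  by rewrite ler_piMr // invf_le1 ?lerDl ?sqr_ge0 // ltr_pwDl // sqr_ge0.
have -> : pi * \int[mu]_x (w x * g x) = - \int[mu]_x (w x * (- pi * g x)).
  rewrite -mulN1r -!RintegralZl //.
  by apply: eq_Rintegral => x _; ring.
exact: cvgN L.
Qed.

End inversion_limit.

(** * Stein identities on Schwartz functions *)

Section stein_identities.
Context {R : realType}.
Notation leb := (@lebesgue_measure R).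
Implicit Types (f : nat -> R -> R) (a b : nat -> R).

Lemma cvg_sum_ord n (u : 'I_n -> nat -> R) (l : 'I_n -> R) :
  (forall i, u i @ \oo --> l i) ->
  (fun m => \sum_(i < n) u i m) @ \oo --> \sum_(i < n) l i.
Proof.
elim: n u l => [|n IH] u l ul.
  by rewrite big_ord0; under eq_fun do rewrite big_ord0; exact: cvg_cst.
rewrite big_ord_recr /=; under eq_fun do rewrite big_ord_recr /=.
by apply: cvgD => //; exact: IH.
Qed.

(** The only decay of Schwartz functions that Fourier inversion uses. *)
Definition decaying f := forall k, exists C : R, forall t, `|f k t| <= C * (1 + t ^+ 2)^-1.

Lemma schwartz_decaying (f : R -> R) : schwartz f ->
  decaying (fun k => f^`(k)%classic).
Proof.
move=> [_ rf] k; have [C0 H0] := rf 0%N k; have [C2 H2] := rf 2%N k.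
exists (C0 + C2) => t.
have t2 : 0 < 1 + t ^+ 2 by rewrite ltr_pwDl // sqr_ge0.
rewrite ler_pdivlMr // mulrDr mulr1; apply: lerD.
  by have := H0 t; rewrite expr0 mul1r.
by have := H2 t; rewrite normrM mulrC (ger0_norm (sqr_ge0 t)).
Qed.

Lemma decaying_pair f k : decaying f -> exists C : R,
  (forall t, `|f k t| <= C * (1 + t ^+ 2)^-1) /\
  (forall t, `|f k.+1 t| <= C * (1 + t ^+ 2)^-1).
Proof.
move=> df; have [C HC] := df k; have [D HD] := df k.+1.
exists (Num.max C D); split=> t.
  apply: le_trans (HC t) _; rewrite ler_wpM2r ?le_max ?lexx //.
  by rewrite invr_ge0 addr_ge0 // sqr_ge0.
apply: le_trans (HD t) _; rewrite ler_wpM2r ?le_max ?lexx ?orbT //.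
by rewrite invr_ge0 addr_ge0 // sqr_ge0.
Qed.

Section transforms.
Variable f : nat -> R -> R.
Hypothesis tf : derivative_tower f.
Hypothesis df : decaying f.

Lemma decaying_integrable k : leb.-integrable setT (EFin \o f k).
Proof. by have [C HC] := df k; exact: decay_integrable (tf k) HC. Qed.

Let cvg_pm k (h : R -> R) (s : R) : `|s| = 1 -> (forall x, `|h x| <= 1) ->
  f k (s * n.+1%:R) * h (s * n.+1%:R) @[n --> \oo] --> 0.
Proof.
move=> s1 h1; have [C HC] := df k.
have := decay_cvg HC 0 s1; under eq_fun do rewrite add0r; move=> /cvgr0_norm_le H.
apply/cvgr0Pnorm_le => e e0.
near=> n; rewrite normrM -[leRHS]mulr1; apply: ler_pM => //.
by near: n; exact: H.
Unshelve. all: by end_near. Qed.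

Lemma cos_transformS k xi :
  cos_transform (f k.+1) xi = xi * sin_transform (f k) xi.
Proof.
have ic := integrable_mulr_cos leb id (decaying_integrable k.+1) (@measurable_id _ _ _) xi.
have is' := integrable_mulr_sin leb id (decaying_integrable k) (@measurable_id _ _ _) xi.
apply/eqP; rewrite -subr_eq0 -RintegralZl // -RintegralB //; last exact: integrableRZ.
apply/eqP.
apply: (@Rintegral_derivative_cvg _ _ (fun n => - n.+1%:R) (fun n => n.+1%:R)
  (fun t => f k t * cos (xi * t))) => //.
- by move=> n; rewrite gtrN // ltr0n.
- move=> t _.
  have [N _ HN] := nbhs_infty_ger (`|t| : R).
  exists N => // n /= Nn; rewrite in_itv /= -ler_norml.
  by apply: le_trans (HN n Nn) _; rewrite ler_nat.
- move=> t.
  have dt := is_derive1Z xi (is_derive_id t (1 : R)).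
  apply: (is_derive_eq (is_derive1M (tf k t)
    (is_derive1_compose (x := t) (is_derive_cos _) dt))).
  by ring.
- move=> t; apply: cvgB.
    apply: cvgM; first exact: (tower_continuous tf).
    by apply: continuous_comp; [exact: mulrl_continuous | exact: continuous_cos].
  apply: cvgM; first exact: cvg_cst.
  apply: cvgM; first exact: (tower_continuous tf).
  by apply: continuous_comp; [exact: mulrl_continuous | exact: continuous_sin].
- by apply: integrableRB => //; exact: integrableRZ.
- rewrite -[X in _ --> X](subr0 (0 : R)); apply: cvgB.
    have := cvg_pm k (h := fun t => cos (xi * t)) (normr1 _) (fun t => normr_cos_le1 _).
    by under eq_fun do rewrite mul1r.
  have := cvg_pm k (s := -1) (h := fun t => cos (xi * t)) _ (fun t => normr_cos_le1 _).
  by under eq_fun do rewrite mulN1r; apply; rewrite normrN normr1.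
Qed.

Lemma sin_transformS k xi :
  sin_transform (f k.+1) xi = - (xi * cos_transform (f k) xi).
Proof.
have is' := integrable_mulr_sin leb id (decaying_integrable k.+1) (@measurable_id _ _ _) xi.
have ic := integrable_mulr_cos leb id (decaying_integrable k) (@measurable_id _ _ _) xi.
apply/eqP; rewrite -addr_eq0 -RintegralZl // -RintegralD //; last exact: integrableRZ.
apply/eqP.
apply: (@Rintegral_derivative_cvg _ _ (fun n => - n.+1%:R) (fun n => n.+1%:R)
  (fun t => f k t * sin (xi * t))) => //.
- by move=> n; rewrite gtrN // ltr0n.
- move=> t _.
  have [N _ HN] := nbhs_infty_ger (`|t| : R).
  exists N => // n /= Nn; rewrite in_itv /= -ler_norml.
  by apply: le_trans (HN n Nn) _; rewrite ler_nat.
- move=> t.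
  have dt := is_derive1Z xi (is_derive_id t (1 : R)).
  apply: (is_derive_eq (is_derive1M (tf k t)
    (is_derive1_compose (x := t) (is_derive_sin _) dt))).
  by ring.
- move=> t; apply: cvgD.
    apply: cvgM; first exact: (tower_continuous tf).
    by apply: continuous_comp; [exact: mulrl_continuous | exact: continuous_sin].
  apply: cvgM; first exact: cvg_cst.
  apply: cvgM; first exact: (tower_continuous tf).
  by apply: continuous_comp; [exact: mulrl_continuous | exact: continuous_cos].
- by apply: integrableRD => //; exact: integrableRZ.
- rewrite -[X in _ --> X](subr0 (0 : R)); apply: cvgB.
    have := cvg_pm k (h := fun t => sin (xi * t)) (normr1 _) (fun t => normr_sin_le1 _).
    by under eq_fun do rewrite mul1r.
  have := cvg_pm k (s := -1) (h := fun t => sin (xi * t)) _ (fun t => normr_sin_le1 _).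
  by under eq_fun do rewrite mulN1r; apply; rewrite normrN normr1.
Qed.

(** In complex form, the k-th derivative multiplies [cos_transform] + i [sin_transform] by (- i
    xi)^k; here (- i)^k is a rotation by - k pi / 2. *)
Lemma transform_tower k xi :
  cos_transform (f k) xi = xi ^+ k * (cos (k%:R * (pi / 2)) * cos_transform (f 0%N) xi +
    sin (k%:R * (pi / 2)) * sin_transform (f 0%N) xi) /\
  sin_transform (f k) xi = xi ^+ k * (cos (k%:R * (pi / 2)) * sin_transform (f 0%N) xi -
    sin (k%:R * (pi / 2)) * cos_transform (f 0%N) xi).
Proof.
elim: k => [|k [IHc IHs]].
  by rewrite mul0r cos0 sin0 expr0 !mul1r !mul0r addr0 subr0.
rewrite cos_transformS sin_transformS IHc IHs -(natr1 k) (mulrDl k%:R) mul1r cosDpihalf sinDpihalf exprS.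
by split; ring.
Qed.

End transforms.

(** The free phase th gives access to both the cosine (th = 0) and the sine (th = - pi / 2). *)
Definition trig_tower (xi th : R) k (x : R) := xi ^+ k * cos (xi * x + th + k%:R * (pi / 2)).

Lemma derivative_trig_tower xi th : derivative_tower (trig_tower xi th).
Proof.
move=> k x.
have dx := is_derive1D (is_derive1D (is_derive1Z xi (is_derive_id x (1 : R)))
  (is_derive_cst th x (1 : R))) (is_derive_cst (k%:R * (pi / 2)) x (1 : R)).
apply: (is_derive_eq (is_derive1Z (xi ^+ k)
  (is_derive1_compose (x := x) (is_derive_cos _) dx))).
rewrite /trig_tower -(natr1 k) (mulrDl k%:R) mul1r addrA cosDpihalf exprS; ring.
Qed.

(** A and B are given a common length n, padded by zeros, so that x A f - B f is one sum with affine
    weights, to each term of which inversion applies. *)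
Definition stein_tower n a b f (x : R) := \sum_(k < n) (a k * x - b k) * f k x.

Definition stein_identity (mu : probability R R) n a b f :=
  \int[mu]_x stein_tower n a b f x = 0.

Lemma integrable_affine (mu : probability R R) (c e : R) :
  mu.-integrable setT (EFin \o (fun x : R => x)) ->
  mu.-integrable setT (EFin \o (fun x : R => c * x - e)).
Proof.
move=> ix; apply: integrableRB => //; first exact: integrableRZ.
exact: finite_measure_integrable_cst.
Qed.

Lemma integrable_stein_term (mu : probability R R) a b f k :
  mu.-integrable setT (EFin \o (fun x : R => x)) ->
  derivative_tower f -> decaying f ->
  mu.-integrable setT (EFin \o (fun x => (a k * x - b k) * f k x)).
Proof.
move=> ix tf df; have [C HC] := df k.
have iw := integrable_affine (a k) (b k) ix.
apply: (integrable_le _ _ (integrableRZ `|C| _ (integrableR_norm iw))) => //.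
  apply: measurable_funM; first exact: integrable_EFin_measurable iw.
  exact: (tower_measurable k tf).
move=> x _; rewrite normrM mulrC ler_wpM2r // (le_trans (HC x)) //.
have x1 : (1 + x ^+ 2)^-1 <= 1 by rewrite invf_le1 ?lerDl ?sqr_ge0 // ltr_pwDl // sqr_ge0.
have x0 : 0 <= (1 + x ^+ 2)^-1 by rewrite invr_ge0 addr_ge0 // sqr_ge0.
by apply: le_trans (ler_norm _) _; rewrite normrM ler_piMr // ger0_norm.
Qed.

(* Fourier inversion of each f^(k); the integrands add up to zero because
   differentiation acts on the transforms as on exp(i xi x). *)
Lemma stein_trig_schwartz (mu : probability R R) n a b f :
  mu.-integrable setT (EFin \o (fun x : R => x)) ->
  (forall xi th, stein_identity mu n a b (trig_tower xi th)) ->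
  derivative_tower f -> decaying f -> stein_identity mu n a b f.
Proof.
move=> ix T tf df.
pose w k (x : R) := a k * x - b k.
have iw k : mu.-integrable setT (EFin \o w k) by exact: integrable_affine.
pose F k xi := cos_transform (f k) xi * \int[mu]_x (w k x * cos (xi * x)) +
  sin_transform (f k) xi * \int[mu]_x (w k x * sin (xi * x)).
have H (k : 'I_n) : (fun m => m.+1%:R * \int[leb]_xi (exponential_pdf m.+1%:R^-1 xi * F k xi))
    @ \oo --> pi * \int[mu]_x (w k x * f k x).
  have [C [HC HC']] := decaying_pair k df.
  have h := fourier_inversion (tf k) (tower_continuous (k := k.+1) tf) HC HC' (iw k).
  exact: h.
have FI m (k : 'I_n) : leb.-integrable setT
    (EFin \o (fun xi => exponential_pdf m.+1%:R^-1 xi * F k xi)).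
  have [C [HC HC']] := decaying_pair k df.
  exact: (fourier_inversion_integrable (tf k) HC).
have iwf (k : 'I_n) : mu.-integrable setT (EFin \o (fun x => w k x * f k x)).
  exact: integrable_stein_term.
rewrite /stein_identity /stein_tower Rintegral_sum //.
(* Multiplied by pi, the sum is the limit of the damped integrals in [H]; it remains to see that
   these add up to 0 for every m. *)
apply: (mulfI (lt0r_neq0 (pi_gt0 R))); rewrite mulr0 mulr_sumr.
apply: (cvg_unique _ (cvg_sum_ord H)) => //.
apply: cvg_near_cst; apply: nearW => m /=.
rewrite -mulr_sumr -Rintegral_sum //.
rewrite (@eq_Rintegral _ _ _ leb setT (cst 0)); last first.
  move=> xi _ /=; rewrite -mulr_sumr.
  suff -> : \sum_(k < n) F k xi = 0 by rewrite mulr0.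
  have iwt th (k : 'I_n) : mu.-integrable setT
      (EFin \o (fun x => w k x * trig_tower xi th k x)).
    apply: (integrable_le _ _ (integrableRZ (`|xi| ^+ k) _ (integrableR_norm (iw k)))) => //.
      apply: measurable_funM; first exact: integrable_EFin_measurable (iw k).
      exact: (tower_measurable k (derivative_trig_tower xi th)).
    move=> x _; rewrite normrM mulrC ler_wpM2r // normrM normrX ler_piMr ?exprn_ge0 //.
    exact: normr_cos_le1.
  pose c0 := cos_transform (f 0%N) xi; pose s0 := sin_transform (f 0%N) xi.
  (* The rotation of the transforms by [transform_tower] can be moved to the phases of cos (xi x)
     and sin (xi x): the sum over k becomes a combination of two trigonometric Stein identities. *)
  transitivity (c0 * (\int[mu]_x stein_tower n a b (trig_tower xi 0) x) +
                s0 * (\int[mu]_x stein_tower n a b (trig_tower xi (- (pi / 2))) x)).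
    rewrite /stein_tower (Rintegral_sum _ (iwt _)) // (Rintegral_sum _ (iwt _)) // !mulr_sumr -big_split /=; apply: eq_bigr => k _.
    have ic := integrable_mulr_cos mu id (iw k) (@measurable_id _ _ _) xi.
    have isn := integrable_mulr_sin mu id (iw k) (@measurable_id _ _ _) xi.
    rewrite /F -!RintegralZl // -!RintegralD //; try exact: integrableRZ.
    apply: eq_Rintegral => x _; rewrite /trig_tower /w.
    have [-> ->] := transform_tower tf df k xi.
    rewrite addr0 addrAC cosBpihalf cosD sinD -/c0 -/s0; ring.
  by rewrite !T !mulr0 addr0.
by rewrite Rintegral_cst // mul0r mulr0.
Qed.

End stein_identities.

(** * Stein identities beyond Schwartz functions *)

Section cutoff.
Context {R : realType}.
Implicit Types (f g : nat -> R -> R).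

Lemma uniform_bound (P : nat -> R -> Prop) :
  (forall i C D, C <= D -> P i C -> P i D) -> (forall i, exists C, P i C) ->
  forall k, exists C, forall i, (i <= k)%N -> P i C.
Proof.
move=> mono ex; elim=> [|k [C HC]].
  by have [C HC] := ex 0%N; exists C => i; rewrite leqn0 => /eqP ->.
have [D HD] := ex k.+1; exists (Num.max C D) => i; rewrite leq_eqVlt => /predU1P[->|ik].
  by apply: mono HD; rewrite le_max lexx orbT.
by apply: mono (HC i ik); rewrite le_max lexx.
Qed.

(** One exponent N serves all the derivatives, so that a single moment, of order N + 1, dominates
    the whole Stein sum. *)
Definition poly_growth N f :=
  forall k, exists C : R, forall x, `|f k x| <= C * (1 + `|x| ^+ N).

Lemma poly_growth_uniform N f k : poly_growth N f ->
  exists2 C : R, 0 <= C & forall i x, (i <= k)%N -> `|f i x| <= C * (1 + `|x| ^+ N).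
Proof.
move=> fN.
pose P i (C : R) := forall x, `|f i x| <= C * (1 + `|x| ^+ N).
have mono i C D : C <= D -> P i C -> P i D.
  by move=> CD H x; apply: le_trans (H x) _; rewrite ler_wpM2r // addr_ge0 // exprn_ge0.
have [C HC] := uniform_bound mono fN k.
exists C; last by move=> i x ik; exact: HC.
have := HC 0%N (leq0n k) 0; move/(le_trans (normr_ge0 _)).
rewrite pmulr_lge0 // ltr_pwDl // exprn_ge0.
Qed.

Definition gauss_cut (d : R) k (x : R) := d ^+ k * gauss_tower k (d * x).

(** Uniform in the scale d, hence a source of dominating functions; for a fixed d, [gauss_cut_decay]
    gives the rapid decay instead. *)
Lemma gauss_cut_le k : exists2 C : R, 0 <= C &
  forall d i x, 0 <= d <= 1 -> (i <= k)%N -> `|gauss_cut d i x| <= C.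
Proof.
pose P i (C : R) := forall x : R, `|gauss_tower i x| <= C.
have exP i : exists C, P i C.
  by have [C HC] := @gauss_tower_le R 0 i; exists C => x; have := HC x; rewrite expr0 mul1r.
have [C HC] := @uniform_bound P (fun i C D CD H x => le_trans (H x) CD) exP k.
exists C; first by apply: le_trans (HC 0%N (leq0n k) 0); exact: normr_ge0.
move=> d i x /andP[d0 d1] ik; rewrite normrM normrX (ger0_norm d0).
rewrite -[leRHS]mul1r; apply: ler_pM => //; first exact: exprn_ge0.
  exact: exprn_ile1.
exact: HC.
Qed.

Lemma gauss_cut_decay (d : R) p k : 0 < d -> exists C : R,
  forall i x, (i <= k)%N -> `|gauss_cut d i x| * (1 + `|x| ^+ p) <= C.
Proof.
move=> d0.
pose P i (C : R) := forall x : R, `|gauss_cut d i x| * (1 + `|x| ^+ p) <= C.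
suff exP i : exists C, P i C.
  have [C HC] := @uniform_bound P (fun i C D CD H x => le_trans (H x) CD) exP k.
  by exists C => i x ik; exact: HC.
have [C0 H0] := @gauss_tower_le R 0 i; have [Cp Hp] := @gauss_tower_le R p i.
exists (d ^+ i * (C0 + Cp / d ^+ p)) => x.
rewrite /gauss_cut normrM normrX (gtr0_norm d0) -mulrA ler_wpM2l ?exprn_ge0 ?(ltW d0) //.
rewrite mulrDr mulr1; apply: lerD.
  by have := H0 (d * x); rewrite expr0 mul1r.
rewrite ler_pdivlMr ?exprn_gt0 //.
have := Hp (d * x); rewrite normrM normrX normrM exprMn (gtr0_norm d0).
by congr (_ <= _); ring.
Qed.

Lemma derivative_gauss_cut d : derivative_tower (gauss_cut d).
Proof. exact: scale_tower derivative_gauss_tower. Qed.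

Lemma gauss_cut_cvg k x :
  gauss_cut n.+1%:R^-1 k x @[n --> \oo] --> ((k == 0)%N%:R : R).
Proof.
have h : (n.+1%:R^-1 : R) @[n --> \oo] --> (0 : R) by exact: cvg_harmonic.
case: k => [|k] /=.
  have -> : (fun n => gauss_cut n.+1%:R^-1 0 x) = (fun n => gauss_tower 0 (n.+1%:R^-1 * x)).
    by apply/funext => n; rewrite /gauss_cut expr0 mul1r.
  rewrite -[X in _ --> X](@gauss_tower00 R).
  apply: continuous_cvg; first exact: tower_continuous derivative_gauss_tower 0.
  by rewrite -[X in _ --> X](mul0r x); apply: cvgM; [exact: h | exact: cvg_cst].
have [C C0 HC] := gauss_cut_le k.+1.
have [D HD] := @gauss_tower_le R 0 k.+1.
apply: (@cvg0_le _ _ (fun n => n.+1%:R^-1 * D)); last first.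
  by rewrite -[X in _ --> X](mul0r D); apply: cvgM; [exact: h | exact: cvg_cst].
move=> n; rewrite normrM; apply: ler_pM => //; last first.
  by have := HD (n.+1%:R^-1 * x); rewrite expr0 mul1r.
rewrite normrX ger0_norm ?invr_ge0 // exprS ler_piMr ?invr_ge0 //.
by rewrite exprn_ile1 ?invr_ge0 // invf_le1 ?ltr0n // ler1n.
Qed.

(* The approximants are the products f(x) exp (- (x / (m + 1)) ^ 2). *)
Lemma schwartz_approximation N f : derivative_tower f -> poly_growth N f ->
  exists h : nat -> nat -> R -> R,
  [/\ forall m, derivative_tower (h m), forall m, schwartz (h m 0%N),
      forall k, exists2 C : R, 0 <= C & forall m x, `|h m k x| <= C * (1 + `|x| ^+ N)
    & forall k x, h ^~ k ^~ x @ \oo --> f k x].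
Proof.
move=> tf fN.
have d01 m : 0 < (m.+1%:R^-1 : R) by rewrite invr_gt0 ltr0n.
have d1 m : (m.+1%:R^-1 : R) <= 1 by rewrite invf_le1 ?ltr0n // ler1n.
pose h m := prod_tower f (gauss_cut m.+1%:R^-1).
have th m : derivative_tower (h m).
  exact: derivative_prod_tower tf (derivative_gauss_cut _).
exists h; split => //.
- move=> m; apply: tower_schwartz => // p k.
  have [C C0 HC] := poly_growth_uniform k fN.
  have [D HD] := gauss_cut_decay (N + p) k (d01 m).
  have [E HE] := gauss_cut_decay p k (d01 m).
  (* Multiplying |x|^p by the growth 1 + |x|^N gives the weights |x|^p and |x|^(N + p), absorbed by
     [E] and [D]. *)
  exists (2 ^+ k * (C * (E + D))) => x; rewrite normrM normrX.
  apply: prod_tower_le => [|i j ijk]; first exact: exprn_ge0.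
  have ik : (i <= k)%N by rewrite -ijk leq_addr.
  have jk : (j <= k)%N by rewrite -ijk leq_addl.
  have h1 := HC i x ik; have h2 := HD j x jk; have h3 := HE j x jk.
  rewrite normrM mulrCA.
  apply: le_trans (ler_wpM2r _ h1) _; first by rewrite mulr_ge0 // exprn_ge0.
  move: h2 h3; rewrite exprD => h2 h3.
  rewrite -!mulrA ler_wpM2l //.
  apply: le_trans (lerD h3 h2).
  have X0 : 0 <= `|x| ^+ p by exact: exprn_ge0.
  have := normr_ge0 (gauss_cut m.+1%:R^-1 j x).
  set G := `|gauss_cut _ _ _|; set X := `|x| ^+ p; set Y := `|x| ^+ N => G0.
  by rewrite -subr_ge0 (_ : _ - _ = G + G) ?addr_ge0 //; ring.
- move=> k.
  have [C C0 HC] := poly_growth_uniform k fN.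
  have [D D0 HD] := gauss_cut_le k.
  exists (2 ^+ k * (C * D)); first by rewrite !mulr_ge0 // exprn_ge0.
  move=> m x; rewrite -mulrA -[leLHS]mul1r; apply: prod_tower_le => // i j ijk.
  rewrite mul1r normrM mulrAC; apply: ler_pM => //.
    by apply: HC; rewrite -ijk leq_addr.
  by apply: HD; [rewrite ltW //= | rewrite -ijk leq_addl].
- move=> k x; rewrite -[X in _ --> X](mulr1 (f k x)).
  apply: (@prod_tower_cvg _ f (fun m => gauss_cut m.+1%:R^-1) (fun j => (j == 0)%N%:R)) => //.
  by move=> j; exact: gauss_cut_cvg.
Qed.

End cutoff.

Section extension.
Context {R : realType}.
Implicit Types (f : nat -> R -> R) (mu nu : probability R R).

(** Dominated convergence along the Schwartz approximants. The moment has order N + 1 rather than N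
    because of the factor x in front of A f. *)
Lemma stein_poly_growth mu N n (a b : nat -> R) f :
  mu.-integrable setT (EFin \o (fun x : R => `|x| ^+ N.+1)) ->
  (forall h : R -> R, schwartz h ->
     stein_identity mu n a b (fun k => h^`(k)%classic)) ->
  derivative_tower f -> poly_growth N f -> stein_identity mu n a b f.
Proof.
move=> iN S tf fN.
have [h [th sh hC hf]] := schwartz_approximation tf fN.
have Sh m : stein_identity mu n a b (h m).
  have -> : h m = fun k => (h m 0%N)^`(k)%classic.
    by apply/funext => k; rewrite tower_derive1n.
  exact: S.
have [D D0 HD] : exists2 D : R, 0 <= D &
    forall m x, `|stein_tower n a b (h m) x| <= D * (1 + `|x| ^+ N.+1).
  pose B k x : R := (`|a k| * `|x| + `|b k|) * (1 + `|x| ^+ N).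
  have Bk k : exists2 D : R, 0 <= D & forall m x,
      `|(a k * x - b k) * h m k x| <= D * (1 + `|x| ^+ N.+1).
    have [C C0 HC] := hC k.
    (* The 4 comes from (1 + y) (1 + y^N) <= 4 (1 + y^(N + 1)), checked separately for y <= 1 and y
       > 1. *)
    exists ((`|a k| + `|b k|) * C * 4); first by rewrite !mulr_ge0 ?addr_ge0.
    move=> m x; rewrite normrM.
    have ax : `|a k * x - b k| <= (`|a k| + `|b k|) * (1 + `|x|).
      apply: le_trans (ler_normB _ _) _; rewrite normrM.
      have := normr_ge0 (a k); have := normr_ge0 (b k); have := normr_ge0 x.
      by nra.
    apply: le_trans (ler_pM (normr_ge0 _) (normr_ge0 _) ax (HC m x)) _.
    rewrite mulrACA -[leRHS]mulrA ler_wpM2l //; first by rewrite mulr_ge0 // addr_ge0.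
    have x0 := normr_ge0 x; have xN := exprn_ge0 N x0; rewrite exprS.
    have [x1|x1] := leP `|x| 1.
      have := exprn_ile1 N x0 x1; by nra.
    have := exprn_ege1 N (ltW x1); by nra.
  elim: n {S Sh} => [|n [D D0 HD]].
    by exists 0 => // m x; rewrite /stein_tower big_ord0 normr0 mul0r.
  have [E E0 HE] := Bk n; exists (D + E); first exact: addr_ge0.
  move=> m x; rewrite /stein_tower big_ord_recr /= (mulrDl D).
  by apply: le_trans (ler_normD _ _) _; apply: lerD; [exact: HD | exact: HE].
have mst m : measurable_fun setT (stein_tower n a b (h m)).
  apply: measurable_sum => k; apply: measurable_funM.
    by apply: measurable_funB => //; exact: measurable_funM.
  exact: (tower_measurable k (th m)).
have [_ L] := @dominated_cvg_Rintegral _ _ _ mu setT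
  (fun m => stein_tower n a b (h m)) (stein_tower n a b f)
  (fun x => D * (1 + `|x| ^+ N.+1)) measurableT mst
  (fun x _ => cvg_sum_ord (fun k : 'I_n => cvgM (cvg_cst (a k * x - b k)) (hf k x)))
  (integrableRZ D measurableT (integrableRD measurableT
    (finite_measure_integrable_cst mu 1 measurableT) iN))
  (fun m x _ => HD m x).
apply: (cvg_unique _ L) => //.
by apply: cvg_near_cst; apply: nearW => m; exact: Sh.
Qed.

Lemma Rintegral_bounded_tower mu nu f :
  (forall h : R -> R, schwartz h -> \int[mu]_x h x = \int[nu]_x h x) ->
  derivative_tower f -> poly_growth 0 f ->
  \int[mu]_x f 0%N x = \int[nu]_x f 0%N x.
Proof.
move=> S tf f0.
have [h [th sh hC hf]] := schwartz_approximation tf f0.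
have [C C0 HC] := hC 0%N.
have L (P : probability R R) : \int[P]_x h m 0%N x @[m --> \oo] --> \int[P]_x f 0%N x.
  have [] := @dominated_cvg_Rintegral _ _ _ P setT (fun m => h m 0%N) (f 0%N)
    (cst (C * (1 + 1))) measurableT => //.
  - by move=> m; exact: (tower_measurable 0 (th m)).
  - exact: finite_measure_integrable_cst.
apply: (cvg_unique _ (L mu)) => //.
have -> : (fun m => \int[mu]_x h m 0%N x) = (fun m => \int[nu]_x h m 0%N x).
  by apply/funext => m; exact: S.
exact: L.
Qed.

End extension.

(** * Logistic functions *)

Section logistic.
Context {R : realType}.
Variables s e : R.
Hypothesis e0 : 0 < e.

(** By f' = s f (1 - e f), with y = e f one has (f p(y))' = s f (1 - y) (p(y) + y p'(y)), whence the
    recurrence. As y lies in [0, 1], the bounds on these polynomials depend neither on s nor on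
    e. *)
Fixpoint logistic_poly k : {poly R} :=
  if k is k'.+1 then (1 - 'X) * (logistic_poly k' + 'X * (logistic_poly k')^`()) else 1.

(* e / (e + exp (- s x)) is the logistic function, up to a translation and a
   rescaling of x; the factor 1 / e makes it increase to exp (s x) as e -> 0. *)
Definition logistic (x : R) := (e + expR (- s * x))^-1.

Definition logistic_tower k (x : R) :=
  s ^+ k * (logistic x * (logistic_poly k).[e * logistic x]).

Let den (x : R) : 0 < e + expR (- s * x).
Proof. by rewrite addr_gt0 // expR_gt0. Qed.

Lemma logistic_gt0 x : 0 < logistic x.
Proof. by rewrite invr_gt0. Qed.

Lemma logistic_scaled_ge0_le1 x : 0 <= e * logistic x <= 1.
Proof.
rewrite mulr_ge0 ?(ltW e0) ?(ltW (logistic_gt0 x)) //=.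
by rewrite /logistic ler_pdivrMr // mul1r lerDl expR_ge0.
Qed.

Lemma is_derive_logistic x :
  is_derive x (1 : R) logistic (s * logistic x * (1 - e * logistic x)).
Proof.
have dx := is_derive1Z (- s) (is_derive_id x (1 : R)).
have h := is_derive1V _ (is_derive1D (is_derive_cst e x (1 : R))
  (is_derive1_compose (x := x) (is_derive_expR _) dx)).
apply: (is_derive_eq (h _)); first by rewrite gt_eqF // den.
rewrite /logistic /cst; set E := expR _; field.
by rewrite gt_eqF // den.
Qed.

Lemma derivative_logistic_tower : derivative_tower logistic_tower.
Proof.
move=> k x.
have dl := is_derive_logistic x.
have h := is_derive1Z (s ^+ k) (is_derive1M dl (is_derive1_compose (x := x)
  (is_derive_poly (logistic_poly k) _) (is_derive1Z e dl))).
apply: (is_derive_eq h).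
rewrite /logistic_tower /= hornerM hornerD hornerN hornerC hornerX hornerD hornerM hornerX.
by rewrite exprS; ring.
Qed.

Lemma poly_bound01 (p : {poly R}) :
  exists2 C : R, 0 <= C & forall y, 0 <= y <= 1 -> `|p.[y]| <= C.
Proof.
elim/poly_ind: p => [|p c [C C0 HC]].
  by exists 0 => // y _; rewrite horner0 normr0.
exists (C + `|c|); first exact: addr_ge0.
move=> y /[dup] y01 /andP[y0 y1]; rewrite hornerMXaddC.
apply: le_trans (ler_normD _ _) _; rewrite lerD2r normrM (ger0_norm y0).
by rewrite -[leRHS]mulr1; apply: ler_pM => //; exact: HC.
Qed.

Lemma logistic_poly_growth : poly_growth 0 logistic_tower.
Proof.
move=> k; have [C C0 HC] := poly_bound01 (logistic_poly k).
exists (`|s| ^+ k * (e^-1 * C)) => x.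
apply: (@le_trans _ _ (`|s| ^+ k * (e^-1 * C))); last first.
  by rewrite ler_peMr // ?lerDl // !mulr_ge0 ?exprn_ge0 // invr_ge0 (ltW e0).
rewrite !normrM normrX ler_wpM2l ?exprn_ge0 //; apply: ler_pM => //.
  rewrite gtr0_norm ?logistic_gt0 // lef_pV2 ?posrE //.
  by rewrite lerDl expR_ge0.
exact/HC/logistic_scaled_ge0_le1.
Qed.

End logistic.

(** * Laws are determined by their trigonometric integrals *)

Lemma cvg_near_harmonic (R : realType) (u : nat -> R) (l : R) :
  (\forall n \near \oo, `|u n - l| <= n.+1%:R^-1) -> u @ \oo --> l.
Proof.
move=> ul; apply/subr_cvg0; apply: norm_cvg0.
apply: (squeeze_cvgr _ (cvg_cst 0) (cvg_harmonic : harmonic @ \oo --> (0 : R))).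
by apply: filterS ul => n H; rewrite normr_ge0.
Qed.

Section uniqueness.
Context {R : realType}.
Variables mu nu : probability R R.
Hypothesis cosE : forall xi : R, \int[mu]_x cos (xi * x) = \int[nu]_x cos (xi * x).
Hypothesis sinE : forall xi : R, \int[mu]_x sin (xi * x) = \int[nu]_x sin (xi * x).

(** Fourier inversion with weight 1: the damped integrals of the two laws coincide for every n,
    hence so do their limits. *)
Lemma Rintegral_schwartz_eq (h : R -> R) : schwartz h ->
  \int[mu]_x h x = \int[nu]_x h x.
Proof.
move=> sh.
have th := schwartz_tower sh; have dh := schwartz_decaying sh.
have [C [HC HC']] := decaying_pair 0 dh.
have i1 (P : probability R R) : P.-integrable setT (EFin \o (cst 1 : R -> R)).
  exact: finite_measure_integrable_cst.
pose I (P : probability R R) n : R := n.+1%:R *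
  \int[@lebesgue_measure R]_xi (exponential_pdf n.+1%:R^-1 xi *
    (cos_transform h xi * \int[P]_x (cst 1 x * cos (xi * x)) +
     sin_transform h xi * \int[P]_x (cst 1 x * sin (xi * x)))).
have L P : I P @ \oo --> pi * \int[P]_x (cst 1 x * h x).
  have inv := fourier_inversion (th 0%N) (tower_continuous (k := 1) th) HC HC' (i1 P).
  exact: inv.
have one (P : probability R R) (g : R -> R) : \int[P]_x (cst 1 x * g x) = \int[P]_x g x.
  by apply: eq_Rintegral => x _; rewrite mul1r.
apply: (mulfI (lt0r_neq0 (pi_gt0 R))).
rewrite -(one mu) -(one nu).
apply: (cvg_unique _ (L mu)) => //.
suff -> : I mu = I nu by exact: L.
apply/funext => n; congr (_ * _).
by apply: eq_Rintegral => xi _; rewrite !one cosE sinE.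
Qed.

Lemma fine_measure_ray (P : probability R R) (t : R) (h : nat -> R -> R) :
  (forall n, measurable_fun setT (h n)) -> (forall n x, 0 <= h n x <= 1) ->
  (forall x, h ^~ x @ \oo --> (\1_(`]-oo, t[%classic) x : R)) ->
  \int[P]_x h n x @[n --> \oo] --> fine (P `]-oo, t[%classic).
Proof.
move=> mh h01 hc.
have mt : measurable (`]-oo, t[%classic : set R) by exact: measurable_itv.
have [] := @dominated_cvg_Rintegral _ _ _ P setT h (\1_(`]-oo, t[%classic)) (cst 1) => //.
- exact: finite_measure_integrable_cst.
- by move=> n x _; have /andP[h0 h1] := h01 n x; rewrite ger0_norm.
by move=> _; rewrite /Rintegral integral_indic // setIT.
Qed.

Lemma measure_ray_eq (t : R) : mu `]-oo, t[%classic = nu `]-oo, t[%classic.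
Proof.
rewrite -[LHS]fineK ?fin_num_measure // -[RHS]fineK ?fin_num_measure //; congr (_%:E).
(* With these parameters, h_n(x) = 1 / (1 + exp ((n + 1)^2 (x - t) + n + 1)). The shift n + 1 sends
   h_n(t) to 0, so that the limit is the indicator of the open ray; the slope (n + 1)^2 overcomes
   the shift at x < t as soon as (n + 1) (t - x) >= 2. *)
pose m n : R := n.+1%:R ^+ 2; pose e n : R := expR (m n * t - n.+1%:R).
pose h n x := e n * logistic (- m n) (e n) x.
have hE n x : h n x = (1 + expR (m n * (x - t) + n.+1%:R))^-1.
  rewrite /h /logistic opprK /e.
  have -> : expR (m n * x) = expR (m n * t - n.+1%:R) * expR (m n * (x - t) + n.+1%:R).
    by rewrite -expRD; congr expR; ring.
  have := expR_gt0 (m n * t - n.+1%:R); have := expR_gt0 (m n * (x - t) + n.+1%:R).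
  set A := expR _; set B := expR _ => A0 B0.
  field; rewrite !gt_eqF //; last by rewrite addr_gt0.
  by rewrite addr_gt0 // mulr_gt0.
have mh n : measurable_fun setT (h n).
  apply: measurable_funM => //; apply: continuous_measurable_fun => x.
  by apply: is_derive_continuous (is_derive_logistic _ _ x); exact: expR_gt0.
have h01 n x : 0 <= h n x <= 1.
  by apply: logistic_scaled_ge0_le1; exact: expR_gt0.
have hc x : h ^~ x @ \oo --> (\1_(`]-oo, t[%classic) x : R).
  apply: cvg_near_harmonic.
  have inv_le (y : R) n : n.+1%:R <= y -> (expR y)^-1 <= n.+1%:R^-1.
    move=> ny; rewrite lef_pV2 ?posrE ?ltr0n ?expR_gt0 //.
    by apply: le_trans ny _; apply: le_trans (expR_ge1Dx y); rewrite lerDr.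
  have [tx|xt] := leP t x.
    apply: nearW => n; rewrite indicE memNset; last first.
      by rewrite /= in_itv /=; apply/negP; rewrite -leNgt.
    rewrite subr0 ger0_norm; last by have /andP[] := h01 n x.
    set y := m n * (x - t) + n.+1%:R.
    have ny : n.+1%:R <= y by rewrite lerDr mulr_ge0 ?sqr_ge0 // subr_ge0.
    rewrite hE; apply: le_trans (inv_le _ _ ny).
    by rewrite lef_pV2 ?posrE ?expR_gt0 ?ltr_pwDl ?expR_ge0 // lerDr.
  have [N _ HN] := nbhs_infty_ger (2 / (t - x) : R).
  exists N => // n /= Nn; rewrite indicE mem_set ?in_itv //= hE.
  set y := m n * (x - t) + n.+1%:R.
  have yn : n.+1%:R <= - y.
    have := HN n Nn; rewrite ler_pdivrMr ?subr_gt0 // => H.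
    have n1 : (n%:R : R) + 1 = n.+1%:R by rewrite natr1.
    have n0 : 0 <= (n%:R : R) by [].
    rewrite /y /m -n1; nra.
  apply: le_trans (inv_le _ _ yn); rewrite expRN invrK.
  have E0 := expR_gt0 y; set E := expR y in E0 *.
  have E1 : 0 < 1 + E by rewrite addr_gt0.
  have -> : (1 + E)^-1 - 1 = - (E / (1 + E)) by field; rewrite gt_eqF.
  rewrite normrN ger0_norm ?divr_ge0 ?(ltW E0) ?(ltW E1) // ler_pdivrMr //; nra.
apply: (cvg_unique _ (fine_measure_ray mh h01 hc)) => //.
have -> : (fun n => \int[mu]_x h n x) = (fun n => \int[nu]_x h n x).
  apply/funext => n.
  have e0 : 0 < e n by exact: expR_gt0.
  have il (P : probability R R) :
      P.-integrable setT (EFin \o logistic (- m n) (e n)).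
    apply: (integrable_le _ _ (finite_measure_integrable_cst P (e n)^-1 measurableT)) => //.
      by apply: continuous_measurable_fun => x; apply: is_derive_continuous (is_derive_logistic _ e0 x).
    move=> x _; rewrite gtr0_norm ?logistic_gt0 // lef_pV2 ?posrE ?lerDl ?expR_ge0 //.
    by rewrite addr_gt0 // expR_gt0.
  have := Rintegral_bounded_tower Rintegral_schwartz_eq
    (derivative_logistic_tower (- m n) e0) (logistic_poly_growth (- m n) e0).
  rewrite /logistic_tower /= => H.
  rewrite /h !RintegralZl //; try exact: il; congr (_ * _).
  transitivity (\int[mu]_x (1 * (logistic (- m n) (e n) x * 1.[e n * logistic (- m n) (e n) x]))).
    by apply: eq_Rintegral => x _; rewrite mul1r hornerC mulr1.
  rewrite -(expr0 (- m n)) H.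
  by apply: eq_Rintegral => x _; rewrite expr0 mul1r hornerC mulr1.
exact: fine_measure_ray.
Qed.

Lemma measure_eq_of_trig (A : set R) : measurable A -> mu A = nu A.
Proof.
pose G : set (set R) := [set B | exists t, B = `]-oo, t[%classic].
move: A; apply: (@measure_unique _ _ R G (fun n => `]-oo, n%:R[%classic)).
- exact: RGenInftyO.measurableE.
- move=> B C [x ->] [y ->]; exists (Num.min x y).
  apply/seteqP; split => z /=; rewrite !in_itv /= lt_min.
    by move=> [-> ->].
  by move=> /andP[].
- by move=> n; exists n%:R.
- apply/seteqP; split => // x _.
  have [N _ HN] := nbhs_infty_ger (x : R).
  exists N.+1 => //=; by rewrite in_itv /= (le_lt_trans (HN N (leqnn N))) // ltr_nat.
- by move=> _ [t ->]; exact: measure_ray_eq.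
- by move=> n; rewrite -ge0_fin_numE // fin_num_measure.
Qed.

End uniqueness.

(** * Exponential moments *)

Section exponential_moments.
Context {R : realType}.
Variable mu : probability R R.

Lemma logistic_le_expR (s e x : R) : 0 < e -> logistic s e x <= expR (s * x).
Proof.
move=> e0; rewrite /logistic mulNr expRN.
rewrite -[leRHS]invrK lef_pV2 ?posrE ?invr_gt0 ?expR_gt0 //.
  by rewrite lerDr ltW.
by rewrite addr_gt0 // invr_gt0 expR_gt0.
Qed.

Lemma logistic_cvg (s x : R) : logistic s n.+1%:R^-1 x @[n --> \oo] --> expR (s * x).
Proof.
have h : n.+1%:R^-1 + expR (- s * x) @[n --> \oo] --> 0 + expR (- s * x).
  by apply: cvgD; [exact: cvg_harmonic | exact: cvg_cst].
rewrite -[expR (s * x)]invrK -expRN -mulNr -[expR (- s * x)]add0r.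
by apply: cvgV h; rewrite add0r gt_eqF // expR_gt0.
Qed.

(* Writing f for the logistic approximation of exp (s x), the derivatives of f
   are O (s^k f) uniformly in e, so that for small s all the terms of the Stein
   identity are absorbed in the term a_0 E [x f]. *)
Lemma exponential_moment_sided n (a b : nat -> R) :
  mu.-integrable setT (EFin \o (fun x : R => x)) -> a 0%N != 0 -> (0 < n)%N ->
  (forall h : R -> R, schwartz h ->
     stein_identity mu n a b (fun k => h^`(k)%classic)) ->
  exists2 s0 : R, 0 < s0 & forall s, `|s| = s0 ->
    mu.-integrable setT (EFin \o (fun x => expR (s * x))).
Proof.
case: n => [//|n] ix a0 _ S.
have [Q Q0 HQ] : exists2 Q : R, 0 <= Q & forall k y, (k < n.+1)%N -> 0 <= y <= 1 ->
    `|(logistic_poly k : {poly R}).[y]| <= Q.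
  pose P k (C : R) := forall y, 0 <= y <= 1 -> `|(logistic_poly k : {poly R}).[y]| <= C.
  have exP k : exists C, P k C.
    by have [C _ HC] := poly_bound01 (logistic_poly k : {poly R}); exists C.
  have [C HC] := @uniform_bound R P (fun i C D CD H y hy => le_trans (H y hy) CD) exP n.+1.
  exists C; last by move=> k y kn; apply: HC; exact: ltnW.
  by apply: le_trans (HC 0%N (leq0n n.+1) 0 _); [exact: normr_ge0 | rewrite lexx ler01].
pose A := Q * \sum_(k < n.+1) (`|a k| + `|b k|) + 1.
have A0 : 0 < A.
  by rewrite ltr_pwDr // mulr_ge0 // sumr_ge0 // => k _; rewrite addr_ge0.
have aa0 : 0 < `|a 0%N| by rewrite normr_gt0.
(* Write f for the logistic function. The error terms will be at most A s0 |x| f + A f. This s0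
   makes A s0 <= |a_0| / 4, and [L] below makes A / L = |a_0| / 4, so that at least half of |a_0|
   |x| f survives. *)
pose s0 := Num.min 1 (`|a 0%N| / (4 * A)).
have s00 : 0 < s0 by rewrite lt_min ltr01 /= divr_gt0 // mulr_gt0.
have s01 : s0 <= 1 by rewrite ge_min lexx.
have As0 : A * s0 <= `|a 0%N| / 4.
  apply: (@le_trans _ _ (A * (`|a 0%N| / (4 * A)))).
    by rewrite ler_pM2l // ge_min lexx orbT.
  by rewrite (_ : A * _ = `|a 0%N| / 4) //; field; rewrite gt_eqF.
pose L := 4 * A / `|a 0%N|.
have L0 : 0 < L by rewrite divr_gt0 // mulr_gt0.
exists s0 => // s sE.
have st_le e x : 0 < e -> exists2 r : R, stein_tower n.+1 a b (logistic_tower s e) x =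
    a 0%N * x * logistic s e x + r & `|r| <= A * (s0 * `|x| + 1) * logistic s e x.
  move=> e0; have f0 := logistic_gt0 s e0 x.
  have y01 := logistic_scaled_ge0_le1 s e0 x.
  have s0_ge0 : 0 <= s0 by exact: ltW.
  have Q1 : 1 <= Q by have := HQ 0%N _ (ltn0Sn n) y01; rewrite hornerC normr1.
  pose u k : R := (a k * x - b k) * logistic_tower s e k x.
  exists (- b 0%N * logistic s e x + \sum_(i < n) u i.+1).
    rewrite /stein_tower big_ord_recl /= /logistic_tower expr0 hornerC !mul1r mulr1 addrA.
    by rewrite mulrBl mulNr.
  have uk k : (k < n)%N -> `|u k.+1| <=
      (`|a k.+1| + `|b k.+1|) * Q * (s0 * `|x| + 1) * logistic s e x.
    move=> kn; rewrite /u /logistic_tower !normrM normrX sE (gtr0_norm f0).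
    have h1 : `|a k.+1 * x - b k.+1| <= `|a k.+1| * `|x| + `|b k.+1|.
      by rewrite -normrM; exact: ler_normB.
    have h2 : s0 ^+ k.+1 <= s0 by rewrite exprS ler_piMr // exprn_ile1.
    have h3 := HQ k.+1 _ (kn : (k.+1 < n.+1)%N) y01.
    have h4 : 0 <= s0 ^+ k.+1 by exact: exprn_ge0.
    set q := `|_.[_]| in h3 *; have q0 : 0 <= q by exact: normr_ge0.
    have h5 : logistic s e x * q <= logistic s e x * Q by rewrite ler_pM2l.
    have h6 := ler_pM (mulr_ge0 (addr_ge0 (mulr_ge0 (normr_ge0 (a k.+1)) (normr_ge0 x))
      (normr_ge0 (b k.+1))) h4) (mulr_ge0 (ltW f0) q0) (lexx _) h5.
    apply: le_trans (_ : (`|a k.+1| * `|x| + `|b k.+1|) * s0 ^+ k.+1 * (logistic s e x * q) <= _).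
      by rewrite -mulrA; apply: ler_wpM2r h1; rewrite mulr_ge0 // mulr_ge0 // ltW.
    apply: le_trans h6 _.
    rewrite (_ : _ * Q * _ * _ = ((`|a k.+1| + `|b k.+1|) * (s0 * `|x| + 1)) * (logistic s e x * Q)); last by ring.
    apply: ler_wpM2r; first by rewrite mulr_ge0 // ltW.
    have := normr_ge0 (a k.+1); have := normr_ge0 (b k.+1); have := normr_ge0 x.
    move: (`|a k.+1|) (`|b k.+1|) (`|x|) => p r z z0 r0 p0.
    have e1 : p * z * s0 ^+ k.+1 <= p * z * s0 by rewrite ler_wpM2l // mulr_ge0.
    have e2 : r * s0 ^+ k.+1 <= r * 1 by rewrite ler_wpM2l // (le_trans h2).
    have e3 : 0 <= r * s0 * z by rewrite !mulr_ge0.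
    by lra.
  apply: le_trans (ler_normD _ _) _.
  have hS := le_trans (ler_norm_sum (index_enum 'I_n) (fun i => u i.+1) xpredT)
    (ler_sum _ (fun (i : 'I_n) _ => uk i (ltn_ord i))).
  apply: le_trans (lerD (lexx _) hS) _.
  rewrite -!mulr_suml normrM normrN (gtr0_norm f0).
  rewrite /A (_ : \sum_(k < n.+1) (`|a k| + `|b k|) =
     `|a 0%N| + `|b 0%N| + \sum_(i < n) (`|a i.+1| + `|b i.+1|)); last by rewrite big_ord_recl.
  have Z0 : 0 <= \sum_(i < n) (`|a i.+1| + `|b i.+1|) by apply: sumr_ge0 => i _; exact: addr_ge0.
  set Z := \sum_(i < n) _ in Z0 *.
  rewrite -mulrDl ler_pM2r //.
  have t1 : 1 <= s0 * `|x| + 1 by rewrite lerDr mulr_ge0.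
  have := normr_ge0 (a 0%N); have := normr_ge0 (b 0%N).
  move: (`|a 0%N|) (`|b 0%N|) (s0 * `|x| + 1) t1 => p q t t1 q0 p0.
  have : q * 1 <= q * (Q * t).
    by apply: ler_wpM2l => //; rewrite -[X in X <= _]mulr1; apply: ler_pM.
  have : 0 <= p * (Q * t) by rewrite !mulr_ge0 //; apply: le_trans t1.
  by nra.
(* For |x| <= L, f <= exp (s x) <= exp L because s0 <= 1; elsewhere 1 <= |x| / L. *)
have f_le e x : 0 < e -> logistic s e x <= expR L + `|x| * logistic s e x / L.
  move=> e0; have f0 := logistic_gt0 s e0 x.
  have [xL|Lx] := leP `|x| L.
    apply: (@le_trans _ _ (expR L)); last first.
      rewrite lerDl; apply: mulr_ge0; first exact: mulr_ge0 (normr_ge0 x) (ltW f0).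
      by rewrite invr_ge0 ltW.
    apply: le_trans (logistic_le_expR s x e0) _; rewrite ler_expR.
    apply: le_trans (ler_norm _) _; rewrite normrM sE.
    by rewrite -[leRHS]mul1r; apply: ler_pM => //; exact: ltW.
  apply: (@le_trans _ _ (`|x| * logistic s e x / L)); last by rewrite lerDr expR_ge0.
  by rewrite ler_pdivlMr // mulrC ler_pM2r // ltW.
(* The sign that turns a_0 x f into |a_0| |x| f where s x >= 0. On the other side f <= 1, and the
   defect is at most 2 |a_0| |x|, integrable by assumption. *)
pose tau := Num.sg s * Num.sg (a 0%N).
(* Chosen so that K (|a_0| / 2) |x| f is the term |x| f / L of [f_le]; thus f <= G. *)
pose K := 2 / (`|a 0%N| * L).
pose H e x := tau * stein_tower n.+1 a b (logistic_tower s e) x + A * expR L +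
  2 * `|a 0%N| * `|x|.
pose G e x := expR L + K * H e x.
have st_ge e x : 0 < e -> `|a 0%N| / 2 * (`|x| * logistic s e x) <=
    H e x.
  move=> e0; rewrite /H; have f0 := logistic_gt0 s e0 x.
  have [r -> Hr] := st_le e x e0.
  have Hf := f_le e x e0.
  have s_neq0 : s != 0 by rewrite -normr_eq0 sE gt_eqF.
  have tauE : `|tau| = 1 by rewrite normrM !normr_sg a0 s_neq0 mulr1.
  have h1 : `|a 0%N| * `|x| * logistic s e x <=
      tau * (a 0%N * x * logistic s e x) + 2 * `|a 0%N| * `|x|.
    have -> : tau * (a 0%N * x * logistic s e x) =
        `|a 0%N| * (Num.sg s * x) * logistic s e x.
      by rewrite (normrEsg (a 0%N)) /tau; ring.
    have : `|x| * logistic s e x <= Num.sg s * x * logistic s e x + 2 * `|x|.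
      have sxE : s * x = `|s| * (Num.sg s * x) by rewrite {1}[s]numEsg; ring.
      have zE : `|Num.sg s * x| = `|x| by rewrite normrM normr_sg s_neq0 mul1r.
      rewrite -zE; set z := Num.sg s * x in sxE *.
      have [z0|z0] := leP 0 z; first by rewrite ger0_norm // lerDl mulr_ge0.
      have f1 : logistic s e x <= 1.
        apply: le_trans (logistic_le_expR s x e0) _; rewrite -expR0 ler_expR sxE.
        by rewrite mulr_ge0_le0 // ltW.
      have : z * logistic s e x >= z * 1 by rewrite ler_wnM2l // ltW.
      by rewrite ltr0_norm //; lra.
    by move=> h; have := ler_wpM2l (normr_ge0 (a 0%N)) h; lra.
  have h2 : - (tau * r) <= A * (s0 * `|x| + 1) * logistic s e x.
    by apply: le_trans Hr; rewrite -[leRHS]mul1r -tauE -normrM lerNl; exact: lerNnormlW.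
  have xf0 : 0 <= `|x| * logistic s e x by rewrite mulr_ge0 // ltW.
  have h3 : A * s0 * (`|x| * logistic s e x) <= `|a 0%N| / 4 * (`|x| * logistic s e x).
    exact: ler_wpM2r.
  have h4 : A * logistic s e x <= A * expR L + `|a 0%N| / 4 * (`|x| * logistic s e x).
    apply: le_trans (ler_wpM2l (ltW A0) Hf) _; rewrite mulrDr lerD2l.
    rewrite (_ : A * _ = `|a 0%N| / 4 * (`|x| * logistic s e x)) // /L.
    by field; rewrite !gt_eqF.
  by rewrite mulrDr; lra.
have f_leG e x : 0 < e -> logistic s e x <= G e x.
  move=> e0; apply: le_trans (f_le e x e0) _; rewrite /G lerD2l.
  have K0 : 0 <= K by rewrite divr_ge0 // mulr_ge0 // ltW.
  apply: le_trans (ler_wpM2l K0 (st_ge e x e0)).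
  rewrite (_ : K * _ = `|x| * logistic s e x / L) // /K.
  by field; rewrite !gt_eqF.
have nx : mu.-integrable setT (EFin \o (fun x : R => `|x|)) by exact: integrableR_norm ix.
have ic c : mu.-integrable setT (EFin \o (cst c : R -> R)).
  exact: finite_measure_integrable_cst.
have ist e : 0 < e ->
    mu.-integrable setT (EFin \o stein_tower n.+1 a b (logistic_tower s e)).
  move=> e0; apply: integrableR_sum => // k.
  have [C HC] := logistic_poly_growth s e0 k.
  have iw := integrable_affine (a k) (b k) ix.
  apply: (integrable_le _ _ (integrableRZ (C * (1 + 1)) _ (integrableR_norm iw))) => //.
    apply: measurable_funM; first exact: integrable_EFin_measurable iw.
    exact: (tower_measurable k (derivative_logistic_tower s e0)).
  by move=> x _; rewrite normrM mulrC ler_wpM2r //; have := HC x; rewrite expr0.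
have iH1 e (e0 : 0 < e) := integrableRD measurableT
  (integrableRZ tau measurableT (ist e e0)) (ic (A * expR L)).
have iH e (e0 : 0 < e) : mu.-integrable setT (EFin \o H e) :=
  integrableRD measurableT (iH1 e e0) (integrableRZ (2 * `|a 0%N|) measurableT nx).
have iG e (e0 : 0 < e) : mu.-integrable setT (EFin \o G e) :=
  integrableRD measurableT (ic _) (integrableRZ K measurableT (iH e e0)).
(* The Stein identity removes the only part of G that depends on e, which makes the bound on the
   integral of f uniform. *)
have intG e : 0 < e -> \int[mu]_x G e x =
    expR L + K * (A * expR L + 2 * `|a 0%N| * \int[mu]_x `|x|).
  move=> e0.
  have int_cst c : \int[mu]_x (cst c x : R) = c.
    rewrite Rintegral_cst //; have mu1 : mu setT = 1%E by exact: probability_setT.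
    by rewrite [X in fine X](_ : _ = 1%E) ?mulr1.
  rewrite (RintegralD measurableT (ic (expR L)) (integrableRZ K measurableT (iH e e0))).
  rewrite (RintegralZl K measurableT (iH e e0)) int_cst.
  rewrite (RintegralD measurableT (iH1 e e0) (integrableRZ (2 * `|a 0%N|) measurableT nx)).
  rewrite (RintegralD measurableT (integrableRZ tau measurableT (ist e e0)) (ic (A * expR L))).
  rewrite (RintegralZl _ measurableT nx) (RintegralZl tau measurableT (ist e e0)) int_cst.
  rewrite [X in tau * X](_ : _ = 0) ?mulr0 ?add0r //.
  apply: (@stein_poly_growth _ mu 0) => //.
  - exact: derivative_logistic_tower.
  - exact: logistic_poly_growth.
apply: (@integrable_cvg_le _ _ _ mu (fun m => logistic s m.+1%:R^-1) _
  (expR L + K * (A * expR L + 2 * `|a 0%N| * \int[mu]_x `|x|))).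
- move=> m; have e0 : 0 < (m.+1%:R^-1 : R) by rewrite invr_gt0 ltr0n.
  apply: (integrable_le _ _ (iG _ e0)) => //.
    exact: continuous_measurable_fun (fun x => is_derive_continuous (is_derive_logistic s e0 x)).
  by move=> x _; rewrite gtr0_norm ?logistic_gt0 //; exact: f_leG.
- by move=> m x; rewrite ltW // logistic_gt0 // invr_gt0 ltr0n.
- by move=> x; exact: logistic_cvg.
- move=> m; have e0 : 0 < (m.+1%:R^-1 : R) by rewrite invr_gt0 ltr0n.
  rewrite -(intG _ e0); apply: le_Rintegral => //.
  + apply: (integrable_le _ _ (iG _ e0)) => //.
      exact: continuous_measurable_fun (fun x => is_derive_continuous (is_derive_logistic s e0 x)).
    by move=> x _; rewrite gtr0_norm ?logistic_gt0 //; exact: f_leG.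
  + exact: iG.
  + by move=> x _; exact: f_leG.
Qed.

End exponential_moments.

(** * Moments and their recurrence *)

Section moments.
Context {R : realType}.
Implicit Type mu : probability R R.

Lemma exponential_moment mu n (a b : nat -> R) :
  mu.-integrable setT (EFin \o (fun x : R => x)) -> a 0%N != 0 -> (0 < n)%N ->
  (forall h : R -> R, schwartz h ->
     stein_identity mu n a b (fun k => h^`(k)%classic)) ->
  exists2 s : R, 0 < s & mu.-integrable setT (EFin \o (fun x : R => expR (s * `|x|))).
Proof.
move=> ix a0 n0 S; have [s s0 H] := exponential_moment_sided ix a0 n0 S.
exists s => //.
have i1 := H s (gtr0_norm s0).
have i2 : mu.-integrable setT (EFin \o (fun x : R => expR (- s * x))).
  by apply: H; rewrite normrN gtr0_norm.
apply: (integrable_le _ _ (integrableRD measurableT i1 i2)) => //.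
  by apply: measurableT_comp => //; exact: measurable_funM.
move=> x _; rewrite ger0_norm ?expR_ge0 //.
have [x0|x0] := leP 0 x; first by rewrite ger0_norm // lerDl expR_ge0.
by rewrite ltr0_norm // mulrN mulNr lerDr expR_ge0.
Qed.

Lemma exprn_le_expR (s y : R) n : 0 < s -> 0 <= y ->
  y ^+ n <= n`!%:R * (s ^- n) * expR (s * y).
Proof.
move=> s0 y0.
have sy0 : 0 <= s * y by rewrite mulr_ge0 // ltW.
have h : (s * y) ^+ n <= n`!%:R * expR (s * y).
  case: n => [|n].
    rewrite expr0 fact0 mul1r; apply: le_trans (expR_ge1Dx _); by rewrite lerDl.
  rewrite [leRHS]mulrC -ler_pdivrMr ?ltr0n ?fact_gt0 //.
  by apply: le_trans (expR_ge1Dxn n sy0); rewrite lerDr.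
rewrite -mulrA mulrCA mulrC ler_pdivlMr ?exprn_gt0 //.
by rewrite mulrC -exprMn.
Qed.

Lemma integrable_moment mu (s : R) n : 0 < s ->
  mu.-integrable setT (EFin \o (fun x : R => expR (s * `|x|))) ->
  mu.-integrable setT (EFin \o (fun x : R => `|x| ^+ n)).
Proof.
move=> s0 ie.
apply: (integrable_le _ _ (integrableRZ (n`!%:R * (s ^- n)) _ ie)) => //.
  by apply: measurable_funX; exact: normr_measurable.
by move=> x _; rewrite ger0_norm ?exprn_ge0 //; exact: exprn_le_expR.
Qed.

(** For k > n the falling factorial is 0, which makes the truncated exponent n - k harmless. *)
Definition power_tower n k (x : R) := (n ^_ k)%:R * x ^+ (n - k).

Lemma derivative_power_tower n : derivative_tower (power_tower n).
Proof.
move=> k x; apply: (is_derive_eq (is_derive1Z (n ^_ k)%:R (is_derive1X (n - k) x))).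
by rewrite /power_tower ffactnSr natrM subnS mulrA.
Qed.

Lemma power_tower_growth n : poly_growth n (power_tower n).
Proof.
move=> k; exists (n ^_ k)%:R => x.
rewrite normrM ger0_norm // ler_wpM2l // normrX.
have [x1|x1] := leP `|x| 1.
  by rewrite (le_trans (exprn_ile1 _ _ x1)) // lerDl exprn_ge0.
apply: (@le_trans _ _ (`|x| ^+ n)); last by rewrite lerDr.
by apply: ler_weXn2l; [exact: ltW | exact: leq_subr].
Qed.

Section two_measures.
Variables (mu nu : probability R R) (n : nat) (a b : nat -> R).
Hypothesis n0 : (0 < n)%N.
Hypothesis a0 : a 0%N != 0.
Hypothesis imu : mu.-integrable setT (EFin \o (fun x : R => x)).
Hypothesis inu : nu.-integrable setT (EFin \o (fun x : R => x)).
Hypothesis Smu : forall h : R -> R, schwartz h ->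
  stein_identity mu n a b (fun k => h^`(k)%classic).
Hypothesis Snu : forall h : R -> R, schwartz h ->
  stein_identity nu n a b (fun k => h^`(k)%classic).

(** The Stein identity of x^m. Only the term k = 0 reaches the moment of order m + 1, the terms with
    k >= 1 stay at order m or below; this is where a_0 != 0 matters. *)
Lemma moment_recurrence (P : probability R R) m :
  (forall k, P.-integrable setT (EFin \o (fun x : R => `|x| ^+ k))) ->
  (forall h : R -> R, schwartz h -> stein_identity P n a b (fun k => h^`(k)%classic)) ->
  a 0%N * \int[P]_x (x ^+ m.+1) = b 0%N * \int[P]_x (x ^+ m) -
    \sum_(i < n.-1) (m ^_ i.+1)%:R *
      (a i.+1 * \int[P]_x (x ^+ (m - i.+1).+1) - b i.+1 * \int[P]_x (x ^+ (m - i.+1))).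
Proof.
move=> iP S.
have iX k : P.-integrable setT (EFin \o (fun x : R => x ^+ k)).
  by apply: (integrable_le _ _ (iP k)) => // x _; rewrite normrX.
have := stein_poly_growth (iP m.+1) S (derivative_power_tower m) (@power_tower_growth m).
rewrite /stein_identity /stein_tower.
have tE (k : nat) x : (a k * x - b k) * power_tower m k x =
    (m ^_ k)%:R * (a k * x ^+ (m - k).+1 - b k * x ^+ (m - k)).
  by rewrite /power_tower exprS; ring.
have it k : P.-integrable setT (EFin \o (fun x : R => (a k * x - b k) * power_tower m k x)).
  have := integrableRZ (m ^_ k)%:R measurableT (integrableRB measurableT
    (integrableRZ (a k) measurableT (iX (m - k).+1)) (integrableRZ (b k) measurableT (iX (m - k)%N))).
  by apply: eq_integrable => // x _ /=; rewrite tE.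
have intE k : \int[P]_x ((a k * x - b k) * power_tower m k x) = (m ^_ k)%:R *
    (a k * \int[P]_x (x ^+ (m - k).+1) - b k * \int[P]_x (x ^+ (m - k))).
  rewrite -(RintegralZl (a k) measurableT (iX _)) -(RintegralZl (b k) measurableT (iX _)).
  rewrite -(RintegralB measurableT (integrableRZ (a k) measurableT (iX _))
    (integrableRZ (b k) measurableT (iX _))).
  rewrite -(RintegralZl _ measurableT (integrableRB measurableT
    (integrableRZ (a k) measurableT (iX _)) (integrableRZ (b k) measurableT (iX _)))).
  by apply: eq_Rintegral => x _; exact: tE.
rewrite (Rintegral_sum measurableT (fun i : 'I_n => it i)).
rewrite (eq_bigr _ (fun (i : 'I_n) _ => intE i)).
case: n n0 => [//|n'] _ /=; rewrite big_ord_recl /= ffactn0 subn0 mul1r => E.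
set T := \sum_(i < n') _.
have {}E : a 0%N * \int[P]_x x ^+ m.+1 - b 0%N * \int[P]_x x ^+ m + T = 0 by exact: E.
by apply/eqP; rewrite -subr_eq0 -E; apply/eqP; ring.
Qed.

Lemma moments_eq m : \int[mu]_x (x ^+ m) = \int[nu]_x (x ^+ m).
Proof.
have [s s0 ie] := exponential_moment imu a0 n0 Smu.
have [t t0 ie'] := exponential_moment inu a0 n0 Snu.
have rmu k := moment_recurrence k (fun j => integrable_moment j s0 ie) Smu.
have rnu k := moment_recurrence k (fun j => integrable_moment j t0 ie') Snu.
elim/ltn_ind: m => -[_|m IH].
  have E (P : probability R R) : \int[P]_x (x ^+ 0) = 1.
    rewrite (_ : \int[P]_x (x ^+ 0) = \int[P]_x (cst 1 x)); last exact: eq_Rintegral.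
    rewrite Rintegral_cst //; have P1 : P setT = 1%E by exact: probability_setT.
    by rewrite [X in fine X](_ : _ = 1%E) ?mulr1.
  by rewrite !E.
apply: (mulfI a0); rewrite rmu rnu IH //; congr (_ - _); apply: eq_bigr => i _.
(* For i >= m the truncated index (m - i.+1).+1 is 1, out of reach of the induction hypothesis when
   m = 0; the falling factorial cancels these terms. *)
have [im|im] := ltnP i m; last by rewrite ffact_small ?mul0r.
by rewrite !IH //; lia.
Qed.

End two_measures.

End moments.

(** * Continuation of equal characteristic functions *)

Section cosine_taylor.
Context {R : realType}.
Implicit Types y t : R.

Definition cos_taylor n y t :=
  \sum_(k < n) t ^+ k / k`!%:R * cos (y + k%:R * (pi / 2)).

Lemma is_derive_cos_taylor n y t :
  is_derive t (1 : R) (cos_taylor n.+1 y) (cos_taylor n (y + pi / 2) t).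
Proof.
elim: n => [|n IH].
  have -> : cos_taylor 1 y = cst (cos y).
    apply/funext => u; rewrite /cos_taylor big_ord_recl big_ord0 expr0 fact0 mul0r.
    by rewrite divr1 mul1r !addr0.
  by rewrite /cos_taylor big_ord0; exact: is_derive_cst.
have -> : cos_taylor n.+2 y = (fun u => cos_taylor n.+1 y u +
    cos (y + n.+1%:R * (pi / 2)) / n.+1`!%:R * u ^+ n.+1).
  by apply/funext => u; rewrite /cos_taylor big_ord_recr /=; congr (_ + _); ring.
apply: (is_derive_eq (is_derive1D IH (is_derive1Z _ (is_derive1X n.+1 t)))).
rewrite [in RHS]/cos_taylor big_ord_recr /=; congr (_ + _).
rewrite factS natrM -(natr1 n) (mulrDl n%:R) mul1r.
have -> : y + (n%:R * (pi / 2) + pi / 2) = y + pi / 2 + n%:R * (pi / 2) by ring.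
field.
by rewrite !pnatr_eq0 -lt0n fact_gt0 /= natr1 pnatr_eq0.
Qed.

Lemma cos_taylor0 n y : cos_taylor n.+1 y 0 = cos y.
Proof.
rewrite /cos_taylor big_ord_recl expr0 fact0 mul0r divr1 mul1r addr0 big1 ?addr0 //.
by move=> i _; rewrite expr0n /= !mul0r.
Qed.

(** Induction on n: the derivative in t of the remainder of order n + 1 at y is the remainder of
    order n at y + pi / 2. *)
Lemma cos_taylor_remainder n y t :
  `|cos (y + t) - cos_taylor n y t| <= `|t| ^+ n / n`!%:R.
Proof.
elim: n y t => [|n IH] y t.
  by rewrite /cos_taylor big_ord0 subr0 expr0 fact0 divr1 normr_cos_le1.
(* The bound plus e = 1 or -1 times the remainder, along the segment from 0 to t. It vanishes at u =
   0 and has nonnegative derivative for u >= 0; the parameter u avoids a discussion of the sign of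
   t. *)
pose H (e u : R) := `|t| ^+ n.+1 / n.+1`!%:R * u ^+ n.+1 +
  e * (cos (y + u * t) - cos_taylor n.+1 y (u * t)).
pose H' (e u : R) := `|t| ^+ n.+1 / n.+1`!%:R * (n.+1%:R * u ^+ n) +
  e * ((cos (y + pi / 2 + u * t) - cos_taylor n (y + pi / 2) (u * t)) * t).
have dH e u : is_derive u (1 : R) (H e) (H' e u).
  have dut := is_derive1M (is_derive_id u (1 : R)) (is_derive_cst t u (1 : R)).
  have h := is_derive1D (is_derive1Z (`|t| ^+ n.+1 / n.+1`!%:R) (is_derive1X n.+1 u))
    (is_derive1Z e (is_derive1D
      (is_derive1_compose (x := u) (is_derive_cos _) (is_derive1D (is_derive_cst y u (1 : R)) dut))
      (is_derive1N (is_derive1_compose (x := u) (is_derive_cos_taylor n y _) dut)))).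
  apply: (is_derive_eq h); rewrite /H' /cst addrAC cosDpihalf /=; ring.
have H'0 e u : `|e| = 1 -> 0 <= u -> 0 <= H' e u.
  move=> e1 u0; have h := IH (y + pi / 2) (u * t).
  have E : `|t| ^+ n.+1 / n.+1`!%:R * (n.+1%:R * u ^+ n) =
      `|u * t| ^+ n / n`!%:R * `|t|.
    rewrite normrM exprMn (ger0_norm u0) factS natrM exprS; field.
    by rewrite nat1r !pnatr_eq0 -lt0n fact_gt0.
  rewrite /H' E; set X := cos _ - _ in h *; set A := _ / n`!%:R in h *.
  have : `|e * (X * t)| <= A * `|t| by rewrite !normrM e1 mul1r ler_wpM2r.
  by rewrite ler_norml => /andP[b1 _]; lra.
have Hge e : `|e| = 1 -> 0 <= H e 1.
  move=> e1; have [|c] := @MVT _ (H e) (H' e) 0 1 ltr01 (fun x _ => dH e x).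
    by apply: continuous_subspaceT => x; exact: is_derive_continuous (dH e x).
  rewrite in_itv /= => /andP[c0 _]; rewrite subr0 mulr1.
  rewrite {2}/H mul0r addr0 cos_taylor0 subrr mulr0 addr0 expr0n mulr0 subr0 => ->.
  exact: H'0 (ltW c0).
have := Hge 1 (normr1 _); have := Hge (-1) (normrN1 _).
rewrite /H expr1n mulr1 !mul1r mulN1r => h1 h2.
by rewrite ler_norml; apply/andP; split; lra.
Qed.

End cosine_taylor.

Section continuation.
Context {R : realType}.
Variables (mu nu : probability R R) (s : R).
Hypothesis s0 : 0 < s.
Hypothesis iemu : mu.-integrable setT (EFin \o (fun x : R => expR (s * `|x|))).
Hypothesis ienu : nu.-integrable setT (EFin \o (fun x : R => expR (s * `|x|))).
Hypothesis momE : forall m, \int[mu]_x (x ^+ m) = \int[nu]_x (x ^+ m).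

(** Up to a shift of phase, the j-th derivative in xi of the integral of cos (xi x + th). *)
Definition cos_moment (P : probability R R) j xi th :=
  \int[P]_x (x ^+ j * cos (xi * x + th)).

Lemma integrable_cos_moment (P : probability R R) j xi th :
  P.-integrable setT (EFin \o (fun x : R => expR (s * `|x|))) ->
  P.-integrable setT (EFin \o (fun x : R => x ^+ j * cos (xi * x + th))).
Proof.
move=> ie; apply: (integrable_le _ _ (integrable_moment j s0 ie)) => //.
  apply: measurable_funM; first exact: exprn_measurable.
  apply: measurableT_comp; first exact: measurable_cos.
  by apply: measurable_funD => //; exact: measurable_funM.
by move=> x _; rewrite normrM normrX ler_piMr ?exprn_ge0 // normr_cos_le1.
Qed.

(** The radius s / 4 does not depend on xi. Indeed |h x|^n / n! <= 2^-n exp (2 |h x|) <= 2^-n exp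
    ((s / 2) |x|), and the other half of s is spent on |x|^j through the constant [c]. *)
Lemma cos_moment_taylor (P : probability R R) j xi h th :
  P.-integrable setT (EFin \o (fun x : R => expR (s * `|x|))) -> `|h| <= s / 4 ->
  exists D : R, forall n, `|cos_moment P j (xi + h) th -
    \sum_(k < n) h ^+ k / k`!%:R * cos_moment P (j + k) xi (th + k%:R * (pi / 2))|
    <= 2^-1 ^+ n * D.
Proof.
move=> ie hs; pose c : R := j`!%:R * (s / 2) ^- j.
exists (c * \int[P]_x expR (s * `|x|)) => n.
have it k := integrable_cos_moment (j + k) xi (th + k%:R * (pi / 2)) ie.
have i0 := integrable_cos_moment j (xi + h) th ie.
pose w k : R := h ^+ k / k`!%:R.
have isum := integrableR_sum measurableT (fun k : 'I_n => integrableRZ (w k) measurableT (it k)).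
have -> : \sum_(k < n) h ^+ k / k`!%:R * cos_moment P (j + k) xi (th + k%:R * (pi / 2)) =
    \int[P]_x \sum_(k < n) (w k * (x ^+ (j + k) * cos (xi * x + (th + k%:R * (pi / 2))))).
  rewrite (Rintegral_sum measurableT (fun k : 'I_n => integrableRZ (w k) measurableT (it k))).
  by apply: eq_bigr => k _; rewrite (RintegralZl _ measurableT (it k)).
rewrite -(RintegralB measurableT i0 isum).
have iB := integrableRB measurableT i0 isum.
apply: le_trans (le_normr_Rintegral measurableT iB) _.
rewrite -(RintegralZl c measurableT ie) -(RintegralZl _ measurableT (integrableRZ c measurableT ie)).
apply: le_Rintegral => //.
- exact: integrableR_norm iB.
- by apply: integrableRZ => //; exact: integrableRZ.
move=> x _.
have -> : x ^+ j * cos ((xi + h) * x + th) -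
    \sum_(k < n) (w k * (x ^+ (j + k) * cos (xi * x + (th + k%:R * (pi / 2))))) =
    x ^+ j * (cos (xi * x + th + h * x) - cos_taylor n (xi * x + th) (h * x)).
  rewrite mulrBr /cos_taylor mulr_sumr; congr (_ - _).
    by congr (_ * cos _); ring.
  by apply: eq_bigr => k _; rewrite /w exprD exprMn addrA; ring.
rewrite normrM normrX.
have h1 := cos_taylor_remainder n (xi * x + th) (h * x).
have s20 : 0 < s / 2 by rewrite divr_gt0.
have h2 := exprn_le_expR j s20 (normr_ge0 x).
have h3 : `|h * x| ^+ n / n`!%:R <= 2^-1 ^+ n * expR (s / 2 * `|x|).
  have y0 : 0 <= 2 * `|h * x| by rewrite mulr_ge0.
  have := @exprn_le_expR R 1 (2 * `|h * x|) n ltr01 y0.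
  rewrite expr1n invr1 mulr1 mul1r exprMn => h4.
  have h5 : expR (2 * `|h * x|) <= expR (s / 2 * `|x|).
    rewrite ler_expR normrM mulrA ler_wpM2r //; lra.
  have t0 : 0 < (2 : R) ^+ n by rewrite exprn_gt0.
  rewrite ler_pdivrMr ?ltr0n ?fact_gt0 // -(ler_pM2l t0); apply: le_trans h4 _.
  by rewrite exprVn !mulrA divff ?gt_eqF // mul1r [leRHS]mulrC ler_wpM2l.
apply: le_trans (ler_pM _ _ h2 (le_trans h1 h3)) _ => //.
have -> : expR (s * `|x|) = expR (s / 2 * `|x|) * expR (s / 2 * `|x|).
  by rewrite -expRD; congr expR; field.
by rewrite /c le_eqVlt; apply/orP; left; apply/eqP; ring.
Qed.

Lemma cos_moment_eq xi j th : cos_moment mu j xi th = cos_moment nu j xi th.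
Proof.
have step xi' h : `|h| <= s / 4 ->
    (forall j th, cos_moment mu j xi' th = cos_moment nu j xi' th) ->
    forall j th, cos_moment mu j (xi' + h) th = cos_moment nu j (xi' + h) th.
  move=> hs E {}j {}th.
  have [D HD] := cos_moment_taylor j xi' th iemu hs.
  have [D' HD'] := cos_moment_taylor j xi' th ienu hs.
  apply/eqP; rewrite -subr_eq0 -normr_le0.
  have L : (fun n => (2^-1 : R) ^+ n * (D + D')) @ \oo --> (0 : R).
    rewrite -[X in _ --> X](mul0r (D + D')); apply: cvgM; last exact: cvg_cst.
    by apply: cvg_expr; rewrite ger0_norm // invf_lt1 // ltr1n.
  apply: (cvgr_to_ge L); apply: nearW => n.
  (* By [E], the two expansions at xi' share their partial sums, called S, which then cancel. *)
  have := HD n; have := HD' n; under eq_bigr do rewrite -E.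
  move: (\sum_(k < n) _) => S h1 h2; rewrite mulrDr.
  rewrite (_ : _ - _ = (cos_moment mu j (xi' + h) th - S) - (cos_moment nu j (xi' + h) th - S)); last by ring.
  by apply: le_trans (ler_normB _ _) _; exact: lerD.
have all N : forall xi, `|xi| <= N%:R * (s / 4) ->
    forall j th, cos_moment mu j xi th = cos_moment nu j xi th.
  elim: N => [|N IH] {}xi.
    rewrite mul0r normr_le0 => /eqP -> {}j {}th.
    have E (P : probability R R) : P.-integrable setT (EFin \o (fun x : R => expR (s * `|x|))) ->
        cos_moment P j 0 th = cos th * \int[P]_x (x ^+ j).
      move=> ie; rewrite -RintegralZl //.
        by apply: eq_Rintegral => x _; rewrite mul0r add0r mulrC.
      by apply: (integrable_le _ _ (integrable_moment j s0 ie)) => // x _; rewrite normrX.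
    by rewrite !E // momE.
  move=> xiN; have N1 : 0 < (N.+1%:R : R) by [].
  have hs : `|xi / N.+1%:R| <= s / 4.
    by rewrite normf_div (ger0_norm (ltW N1)) ler_pdivrMr // mulrC.
  (* The segment from 0 to xi is cut into N + 1 equal steps, each of length at most s / 4. *)
  have -> : xi = (xi - xi / N.+1%:R) + xi / N.+1%:R by rewrite subrK.
  apply: step => //; apply: IH.
  have -> : xi - xi / N.+1%:R = N%:R * (xi / N.+1%:R).
    by rewrite -(natr1 N); field; rewrite natr1 pnatr_eq0.
  by rewrite normrM ger0_norm // ler_wpM2l.
have [N _ HN] := nbhs_infty_ger (`|xi| / (s / 4) : R).
apply: (all N); rewrite -ler_pdivrMr ?divr_gt0 //.
exact: HN (leqnn N).
Qed.

End continuation.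

(** * The differential equation *)

Section symbols.
Context {R : realType}.
Implicit Types (a b : nat -> R) (xi : R).

(* i ^ k is written cos (k pi / 2) + i sin (k pi / 2). *)
Definition re_symbol n a : {poly R} := \sum_(k < n) (a k * cos (k%:R * (pi / 2))) *: 'X^k.
Definition im_symbol n a : {poly R} := \sum_(k < n) (a k * sin (k%:R * (pi / 2))) *: 'X^k.

Lemma re_symbolE n a xi :
  (re_symbol n a).[xi] = \sum_(k < n) a k * cos (k%:R * (pi / 2)) * xi ^+ k.
Proof. by rewrite /re_symbol horner_sum; apply: eq_bigr => k _; rewrite hornerZ hornerXn. Qed.

Lemma im_symbolE n a xi :
  (im_symbol n a).[xi] = \sum_(k < n) a k * sin (k%:R * (pi / 2)) * xi ^+ k.
Proof. by rewrite /im_symbol horner_sum; apply: eq_bigr => k _; rewrite hornerZ hornerXn. Qed.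

Lemma re_symbol0 n a : (re_symbol n.+1 a).[0] = a 0%N.
Proof.
rewrite re_symbolE big_ord_recl mul0r cos0 expr0 !mulr1 big1 ?addr0 // => i _.
by rewrite expr0n mulr0.
Qed.

Lemma im_symbol0 n a : (im_symbol n a).[0] = 0.
Proof.
rewrite im_symbolE big1 // => -[[|k] kn] _ /=.
  by rewrite mul0r sin0 mulr0 mul0r.
by rewrite expr0n mulr0.
Qed.

Definition csymbol n a (z : R[i]) : R[i] := \sum_(k < n) (a k)%:C * z ^+ k.

Lemma complex_iX xi k : ('i%C * xi%:C) ^+ k =
  (xi ^+ k * cos (k%:R * (pi / 2))) +i* (xi ^+ k * sin (k%:R * (pi / 2))).
Proof.
elim: k => [|k IH]; first by rewrite !expr0 mul0r cos0 sin0 mulr1 mulr0.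
rewrite exprS IH -(natr1 k) (mulrDl k%:R) mul1r cosDpihalf sinDpihalf exprS.
by simpc; congr (_ +i* _); ring.
Qed.

Lemma csymbolE n a xi :
  csymbol n a ('i%C * xi%:C) = (re_symbol n a).[xi] +i* (im_symbol n a).[xi].
Proof.
rewrite re_symbolE im_symbolE /csymbol.
elim: n => [|n IH]; first by rewrite !big_ord0.
rewrite !big_ord_recr /= IH complex_iX.
by simpc; congr (_ +i* _); congr (_ + _); ring.
Qed.

(** The length n is kept after the shift: as the coefficients vanish from n on, the sum is merely
    padded by zeros, and A and B keep a common length. *)
Lemma csymbol_shift n a m z : (forall k, (k < m)%N -> a k = 0) ->
  (forall k, (n <= k)%N -> a k = 0) ->
  csymbol n a z = z ^+ m * csymbol n (fun k => a (k + m)%N) z.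
Proof.
move=> am an; rewrite /csymbol.
have E1 : \sum_(k < n) (a k)%:C * z ^+ k = \sum_(k < m + n) (a k)%:C * z ^+ k.
  rewrite addnC big_split_ord /= [X in _ = _ + X]big1 ?addr0 // => k _.
  by rewrite an ?leq_addr // mul0r.
rewrite E1 big_split_ord /= big1 ?add0r; last by move=> k _; rewrite am // mul0r.
by rewrite mulr_sumr; apply: eq_bigr => k _; rewrite exprD addnC mulrCA.
Qed.

End symbols.

(** * Limits of derivatives *)

Section derivative_limit.
Context {R : realType}.

Lemma derivative_cvg_seq (g : R -> R) (x d : R) (h : nat -> R) :
  is_derive x (1 : R) g d -> (forall n, h n != 0) -> h @ \oo --> (0 : R) ->
  (g (h n + x) - g x) / h n @[n --> \oo] --> d.
Proof.
move=> [dg <-] hn hc.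
have : h^-1 *: ((g \o shift x) (h *: (1 : R)) - g x) @[h --> 0^'] --> 'D_1 g x by exact: dg.
move=> /cvgr_dnbhsP /(_ h (conj hn hc)).
rewrite (_ : (fun n => (h n)^-1 *: _) = (fun n => (g (h n + x) - g x) / h n)) //.
by apply/funext => n /=; rewrite scaler1 mulrC.
Qed.

(** A derivative need not be continuous, but it has no removable discontinuity: by the mean value
    theorem, the difference quotients at 0 are values of k at points that tend to 0. *)
Lemma derivative_limit (g g' k : R -> R) :
  (forall x, is_derive x (1 : R) g (g' x)) -> (forall x, x != 0 -> g' x = k x) ->
  {for 0, continuous k} -> g' 0 = k 0.
Proof.
move=> dg gk ck.
pose h n : R := n.+1%:R^-1.
have h0 n : 0 < h n by rewrite invr_gt0 ltr0n.
have hc : h @ \oo --> (0 : R) by exact: cvg_harmonic.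
have mvt n : exists2 c, 0 < c < h n & (g (h n) - g 0) / h n = k c.
  have [|c] := @MVT _ g g' 0 (h n) (h0 n) (fun x _ => dg x).
    by apply: continuous_subspaceT => x; exact: is_derive_continuous (dg x).
  rewrite in_itv /= subr0 => ch ->; exists c => //.
  by rewrite mulfK ?gt_eqF // gk // gt_eqF //; case/andP: ch.
have [c Hc] := choice (fun n => let: ex_intro2 c h1 h2 := mvt n in ex_intro (fun c => 0 < c < h n /\ (g (h n) - g 0) / h n = k c) c (conj h1 h2)).
have cc : c @ \oo --> (0 : R).
  apply: (cvg0_le _ hc) => n; have [/andP[c0 ch] _] := Hc n.
  by rewrite gtr0_norm // ltW.
have L1 : k (c n) @[n --> \oo] --> k 0 by exact: continuous_cvg ck cc.
have L2 : (g (h n) - g 0) / h n @[n --> \oo] --> g' 0.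
  have hn n : h n != 0 by rewrite gt_eqF.
  by have := derivative_cvg_seq (dg 0) hn hc; under eq_fun do rewrite addr0.
have E : (fun n => (g (h n) - g 0) / h n) = (fun n => k (c n)).
  by apply/funext => n; exact: (Hc n).2.
by rewrite E in L2; exact: (cvg_unique _ L2 L1).
Qed.

End derivative_limit.

Section characteristic_ode.
Context {R : realType}.
Implicit Types (mu : probability R R) (a b : nat -> R).

Definition re_char mu xi := \int[mu]_x cos (xi * x).
Definition im_char mu xi := \int[mu]_x sin (xi * x).

Lemma continuous_horner (p : {poly R}) : continuous (fun x => p.[x]).
Proof. by move=> x; apply: is_derive_continuous (is_derive_poly p x). Qed.

Lemma re_char0 mu : re_char mu 0 = 1.
Proof.
rewrite /re_char (_ : \int[mu]_x cos (0 * x) = \int[mu]_x (cst 1 x)).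
  rewrite Rintegral_cst //; have mu1 : mu setT = 1%E by exact: probability_setT.
  by rewrite [X in fine X](_ : _ = 1%E) ?mulr1.
by apply: eq_Rintegral => x _; rewrite mul0r cos0.
Qed.

Lemma im_char0 mu : im_char mu 0 = 0.
Proof.
rewrite /im_char (_ : \int[mu]_x sin (0 * x) = \int[mu]_x (cst 0 x)).
  by rewrite Rintegral_cst // mul0r.
by apply: eq_Rintegral => x _; rewrite mul0r sin0.
Qed.

(* Real and imaginary parts of A(i xi) (c' + i s') = i B(i xi) (c + i s). *)
Definition ode_re n a b (c s c' s' : R -> R) xi :=
  (re_symbol n a).[xi] * c' xi - (im_symbol n a).[xi] * s' xi =
  - ((re_symbol n b).[xi] * s xi + (im_symbol n b).[xi] * c xi).
Definition ode_im n a b (c s c' s' : R -> R) xi :=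
  (re_symbol n a).[xi] * s' xi + (im_symbol n a).[xi] * c' xi =
  (re_symbol n b).[xi] * c xi - (im_symbol n b).[xi] * s xi.

Section ode.
Variables (n : nat) (a b : nat -> R) (c s c' s' : R -> R).
Hypothesis dc : forall x, is_derive x (1 : R) c (c' x).
Hypothesis ds : forall x, is_derive x (1 : R) s (s' x).

Lemma ode_complexP xi :
  csymbol n a ('i%C * xi%:C) * (c' xi +i* s' xi) =
    'i%C * csymbol n b ('i%C * xi%:C) * (c xi +i* s xi) <->
  ode_re n a b c s c' s' xi /\ ode_im n a b c s c' s' xi.
Proof.
rewrite !csymbolE /ode_re /ode_im; simpc; split.
  by move=> [-> ->]; split; ring.
by move=> [E1 E2]; congr (_ +i* _); [rewrite E1; ring | rewrite E2; ring].
Qed.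

Let cc : continuous c. Proof. by move=> x; exact: is_derive_continuous (dc x). Qed.
Let cs : continuous s. Proof. by move=> x; exact: is_derive_continuous (ds x). Qed.

(** Since c' and s' may be discontinuous at 0, the equation does not pass to the limit directly. By
    the product rule it gives the derivatives of the real and imaginary parts of A(i xi) (c + i s)
    away from 0 as continuous functions, and [derivative_limit] applies. *)
Lemma ode_at0 : (forall xi, xi != 0 -> ode_re n a b c s c' s' xi /\ ode_im n a b c s c' s' xi) ->
  ode_re n a b c s c' s' 0 /\ ode_im n a b c s c' s' 0.
Proof.
move=> E.
have da x := is_derive_poly (re_symbol n a) x.
have db x := is_derive_poly (im_symbol n a) x.
pose ra' x := ((re_symbol n a)^`()).[x]; pose ia' x := ((im_symbol n a)^`()).[x].
have cp p : {for 0, continuous (fun x : R => (p : {poly R}).[x])} by exact: continuous_horner.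
split.
- pose k x := ra' x * c x - ia' x * s x -
    ((re_symbol n b).[x] * s x + (im_symbol n b).[x] * c x).
  have du x := is_derive1D (is_derive1M (da x) (dc x)) (is_derive1N (is_derive1M (db x) (ds x))).
  have := derivative_limit (k := k) du; rewrite /ode_re /k => H.
  have /H H1 : forall x : R, x != 0 -> (re_symbol n a)^`().[x] * c x + (re_symbol n a).[x] * c' x +
     - ((im_symbol n a)^`().[x] * s x + (im_symbol n a).[x] * s' x) = k x.
    by move=> x /E [E1 _]; rewrite /k -E1 /ra' /ia'; ring.
  have : {for 0, continuous k}.
    by apply: cvgB; [apply: cvgB|apply: cvgD]; apply: cvgM; first [exact: cp | exact: cc | exact: cs].
  by move=> /H1; rewrite /ra' /ia' => H2; lra.
- pose k x := ra' x * s x + ia' x * c x +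
    ((re_symbol n b).[x] * c x - (im_symbol n b).[x] * s x).
  have du x := is_derive1D (is_derive1M (da x) (ds x)) (is_derive1M (db x) (dc x)).
  have := derivative_limit (k := k) du; rewrite /ode_im /k => H.
  have /H H1 : forall x : R, x != 0 -> (re_symbol n a)^`().[x] * s x + (re_symbol n a).[x] * s' x +
     ((im_symbol n a)^`().[x] * c x + (im_symbol n a).[x] * c' x) = k x.
    by move=> x /E [_ E2]; rewrite /k -E2 /ra' /ia'; ring.
  have : {for 0, continuous k}.
    by apply: cvgD; [apply: cvgD|apply: cvgB]; apply: cvgM; first [exact: cp | exact: cc | exact: cs].
  by move=> /H1; rewrite /ra' /ia' => H2; lra.
Qed.

End ode.

End characteristic_ode.

Section ode_consequences.
Context {R : realType}.
Implicit Types (mu : probability R R) (a b : nat -> R).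

Lemma ode_shift n a b m (c s c' s' : R -> R) :
  (forall x, is_derive x (1 : R) c (c' x)) -> (forall x, is_derive x (1 : R) s (s' x)) ->
  (forall k, (k < m)%N -> a k = 0 /\ b k = 0) ->
  (forall k, (n <= k)%N -> a k = 0 /\ b k = 0) ->
  (forall xi, ode_re n a b c s c' s' xi /\ ode_im n a b c s c' s' xi) ->
  let a' k := a (k + m)%N in let b' k := b (k + m)%N in
  forall xi, ode_re n a' b' c s c' s' xi /\ ode_im n a' b' c s c' s' xi.
Proof.
move=> dc ds abm abn E a' b'.
have nz xi : xi != 0 -> ode_re n a' b' c s c' s' xi /\ ode_im n a' b' c s c' s' xi.
  move=> xi0; apply/ode_complexP; have /ode_complexP := E xi.
  rewrite (@csymbol_shift _ n a m) => [|k /abm[]//|k /abn[]//].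
  rewrite (@csymbol_shift _ n b m) => [|k /abm[]//|k /abn[]//].
  set z := 'i%C * xi%:C => H.
  have z0 : z ^+ m != 0.
    by rewrite expf_neq0 // /z; simpc; rewrite eq_complex /= negb_and xi0 orbT.
  by apply: (mulfI z0); rewrite !mulrA H; ring.
move=> xi; have [->|/nz//] := eqVneq xi 0.
exact: (ode_at0 dc ds nz).
Qed.

(** Solving for c' gives D c' = N with D = |A(i xi)|^2, so D(0) = a_0^2 != 0. N is differentiable
    and N(0) = 0, hence c'(t) = O(t) near 0, and 1 - c(h) = - c'(t) h for some t in ]0, h[ is
    O(h^2). *)
Lemma ode_second_difference n a b (c s c' s' : R -> R) :
  (forall x, is_derive x (1 : R) c (c' x)) -> (forall x, is_derive x (1 : R) s (s' x)) ->
  (forall xi, ode_re n.+1 a b c s c' s' xi /\ ode_im n.+1 a b c s c' s' xi) ->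
  a 0%N != 0 -> c 0 = 1 -> s 0 = 0 ->
  exists K : R, \forall m \near \oo, (1 - c m.+1%:R^-1) / m.+1%:R^-1 ^+ 2 <= K.
Proof.
move=> dc ds E a0 c0 s0.
pose ra := re_symbol n.+1 a; pose ia := im_symbol n.+1 a.
pose rb := re_symbol n.+1 b; pose ib := im_symbol n.+1 b.
pose N x := - (ra.[x] * (rb.[x] * s x + ib.[x] * c x)) + ia.[x] * (rb.[x] * c x - ib.[x] * s x).
pose D x := ra.[x] ^+ 2 + ia.[x] ^+ 2.
have DN x : D x * c' x = N x.
  by have [E1 E2] := E x; rewrite /N /rb /ib -E2 -[_ * s x + _]opprK -E1 /D /ra /ia; ring.
have dp p x := is_derive_poly (p : {poly R}) x.
have [d dN] : exists d, is_derive (0 : R) (1 : R) N d.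
  have h := is_derive1D
  (is_derive1N (is_derive1M (dp ra 0) (is_derive1D (is_derive1M (dp rb 0) (ds 0)) (is_derive1M (dp ib 0) (dc 0)))))
  (is_derive1M (dp ia 0) (is_derive1D (is_derive1M (dp rb 0) (dc 0)) (is_derive1N (is_derive1M (dp ib 0) (ds 0))))).
  by eexists; exact: h.
have N0 : N 0 = 0 by rewrite /N /ia /ib !im_symbol0 s0; ring.
have D0 : D 0 = a 0%N ^+ 2 by rewrite /D /ra /ia im_symbol0 re_symbol0 expr0n addr0.
pose h m : R := m.+1%:R^-1.
have h0 m : 0 < h m by rewrite invr_gt0 ltr0n.
have hc : h @ \oo --> (0 : R) by exact: cvg_harmonic.
have mvt m : exists t, 0 < t < h m /\ c (h m) - c 0 = c' t * h m.
  have [|t] := @MVT _ c c' 0 (h m) (h0 m) (fun x _ => dc x).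
    by apply: continuous_subspaceT => x; exact: is_derive_continuous (dc x).
  by rewrite in_itv /= subr0 => th ->; exists t.
have [t Ht] := choice mvt.
have t0 m : 0 < t m by have [/andP[]] := Ht m.
have tc : t @ \oo --> (0 : R).
  apply: (cvg0_le _ hc) => m; have [/andP[_ th] _] := Ht m.
  by rewrite gtr0_norm // ltW.
have LN : N (t m) / t m @[m --> \oo] --> d.
  have := derivative_cvg_seq dN (fun m => lt0r_neq0 (t0 m)) tc.
  by under eq_fun do rewrite addr0 N0 subr0.
have LD : D (t m) @[m --> \oo] --> a 0%N ^+ 2.
  rewrite -D0; apply: continuous_cvg tc.
  by apply: cvgD; apply: cvgM; exact: continuous_horner.
have a20 : 0 < a 0%N ^+ 2 by rewrite exprn_even_gt0.
have Ll : `|N (t m) / t m / D (t m)| @[m --> \oo] --> `|d / a 0%N ^+ 2|.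
  by apply: cvg_norm; apply: cvgM => //; apply: cvgV => //; exact: lt0r_neq0.
set l := `|_ / _| in Ll.
exists (l + 1); near=> m.
have Dm : 0 < D (t m).
  near: m; exact: cvgr_gt LD _ a20.
have : `|N (t m) / t m / D (t m)| < l + 1.
  by near: m; apply: cvgr_lt Ll _ _; rewrite ltrDl ltr01.
have [/andP[_ th] Em] := Ht m.
rewrite -DN; rewrite c0 in Em => H.
have -> : (1 - c m.+1%:R^-1) / m.+1%:R^-1 ^+ 2 = - c' (t m) / h m.
  rewrite -/(h m) -opprB Em; field; by rewrite gt_eqF.
apply: le_trans (ler_norm _) _.
rewrite normrM normrN (gtr0_norm (x := (h m)^-1)) ?invr_gt0 //.
apply: ltW; apply: le_lt_trans H.
have -> : D (t m) * c' (t m) / t m / D (t m) = c' (t m) / t m.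
  by field; rewrite !gt_eqF.
rewrite normrM (gtr0_norm (x := (t m)^-1)) ?invr_gt0 // ler_wpM2l //.
by rewrite lef_pV2 ?posrE // ltW.
Unshelve. all: by end_near. Qed.

(** As h tends to 0, (1 - cos (h x)) / h^2 tends to x^2 / 2. Fatou's lemma gives the second moment,
    and |x| <= 1 + x^2 / 2 the first. *)
Lemma integrable_second_difference mu K :
  (\forall m \near \oo, (1 - re_char mu m.+1%:R^-1) / m.+1%:R^-1 ^+ 2 <= K) ->
  mu.-integrable setT (EFin \o (fun x : R => x)).
Proof.
move=> [N _ HN].
(* The offset N makes the eventual bound hold for every index. *)
pose h m : R := (m + N).+1%:R^-1.
have h0 m : 0 < h m by rewrite invr_gt0 ltr0n.
have hc : h @ \oo --> (0 : R).
  by rewrite (cvg_shiftn N (fun m => m.+1%:R^-1 : R)); exact: cvg_harmonic.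
have icos xi : mu.-integrable setT (EFin \o (fun x : R => cos (xi * x))).
  apply: (integrable_le _ _ (finite_measure_integrable_cst mu 1 measurableT)) => //.
    by apply: measurableT_comp; [exact: measurable_cos | exact: measurable_funM].
  by move=> x _; exact: normr_cos_le1.
have i1 : mu.-integrable setT (EFin \o (cst 1 : R -> R)) by exact: finite_measure_integrable_cst.
pose f m x := (h m) ^- 2 * (1 - cos (h m * x)).
have if_ m : mu.-integrable setT (EFin \o f m).
  exact: integrableRZ measurableT (integrableRB measurableT i1 (icos _)).
have iq : mu.-integrable setT (EFin \o (fun x : R => 2 * (x / 2) ^+ 2)).
  apply: (integrable_cvg_le (C := K) if_).
  - move=> m x; apply: mulr_ge0; first by rewrite invr_ge0 exprn_ge0 // ltW.
    by rewrite subr_ge0 cos_le1.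
  - move=> x.
    (* 1 - cos (h x) = 2 sin (h x / 2)^2, written with a difference quotient at 0 of t -> sin (t x /
       2). *)
    have -> : f ^~ x = (fun m => 2 * ((sin ((h m + 0) * (x / 2)) - sin (0 * (x / 2))) / h m) ^+ 2).
      apply/funext => m; rewrite /f addr0 mul0r sin0 subr0.
      have -> : h m * x = h m * (x / 2) + h m * (x / 2) by field.
      rewrite cosD -[X in X - (_ - _)](cos2Dsin2 (h m * (x / 2))); field.
      by rewrite gt_eqF.
    apply: cvgM; first exact: cvg_cst.
    have dg := is_derive1_compose (x := 0) (is_derive_sin _)
      (is_derive1M (is_derive_id (0 : R) (1 : R)) (is_derive_cst (x / 2) (0 : R) (1 : R))).
    have := derivative_cvg_seq dg (fun m => lt0r_neq0 (h0 m)) hc.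
    rewrite mul0r cos0 mul1r mul1r mulr0 addr0 => L.
    exact: (cvgM L L).
  - move=> m; rewrite /f (RintegralZl _ measurableT (integrableRB measurableT i1 (icos _))).
    rewrite (RintegralB measurableT i1 (icos _)).
    have := HN (m + N)%N (leq_addl _ _); rewrite -/(h m) mulrC; apply: le_trans.
    rewrite ler_pM2l ?invr_gt0 ?exprn_gt0 // lerD2r.
    rewrite -[leRHS](re_char0 mu) /re_char; apply: le_Rintegral => //.
    by move=> x _; rewrite mul0r cos0.
apply: (integrable_le _ _ (integrableRD measurableT i1 iq)) => //.
move=> x _ /=; rewrite /cst.
have -> : 2 * (x / 2) ^+ 2 = `|x| ^+ 2 / 2 by rewrite (real_normK (num_real x)); field.
by have := sqr_ge0 (`|x| - 1); have := normr_ge0 x; nra.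
Qed.

End ode_consequences.

(** * Stein identity and equation for one law; uniqueness *)

Section laws.
Context {R : realType}.
Implicit Types (mu nu : probability R R) (a b : nat -> R).

Section integrable_law.
Variable mu : probability R R.
Hypothesis ix : mu.-integrable setT (EFin \o (fun x : R => x)).

Definition re_char_diff xi := - \int[mu]_x (x * sin (xi * x)).
Definition im_char_diff xi := \int[mu]_x (x * cos (xi * x)).

Let i1 : mu.-integrable setT (EFin \o (cst 1 : R -> R)).
Proof. exact: finite_measure_integrable_cst. Qed.

Let icos xi : mu.-integrable setT (EFin \o (fun x : R => cos (xi * x))).
Proof.
have := integrable_mulr_cos mu id i1 (@measurable_id _ _ _) xi.
by apply: eq_integrable => // x _ /=; rewrite mul1r.
Qed.

Let isin xi : mu.-integrable setT (EFin \o (fun x : R => sin (xi * x))).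
Proof.
have := integrable_mulr_sin mu id i1 (@measurable_id _ _ _) xi.
by apply: eq_integrable => // x _ /=; rewrite mul1r.
Qed.

Let ixcos xi : mu.-integrable setT (EFin \o (fun x : R => x * cos (xi * x))).
Proof. exact: (integrable_mulr_cos mu id ix (@measurable_id _ _ _) xi). Qed.

Let ixsin xi : mu.-integrable setT (EFin \o (fun x : R => x * sin (xi * x))).
Proof. exact: (integrable_mulr_sin mu id ix (@measurable_id _ _ _) xi). Qed.

Lemma is_derive_under_integral (f f' : R -> R -> R) xi :
  (forall t, mu.-integrable setT (EFin \o f t)) ->
  (forall t x, is_derive t (1 : R) (f ^~ x) (f' t x)) ->
  (forall t x, `|f' t x| <= `|x|) ->
  is_derive xi (1 : R) (fun t => \int[mu]_x f t x) (\int[mu]_x f' xi x).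
Proof.
move=> fi df f'x.
have Ixi : `]xi - 1, xi + 1[%classic xi by rewrite /= in_itv /= ltrBlDr ltrDl ltr01.
have pE t x : partial1of2 f t x = f' t x by rewrite /partial1of2 derive1E; have [] := df t x.
have der (t x : R) : `]xi - 1, xi + 1[%classic t -> setT x -> derivable (f ^~ x) t 1.
  by move=> _ _; have [] := df t x.
have bnd (t x : R) : `]xi - 1, xi + 1[%classic t -> setT x -> `|partial1of2 f t x| <= `|x|.
  by move=> _ _; rewrite pE.
apply: DeriveDef.
  exact: (derivable_under_integral measurableT Ixi (fun t _ => fi t) der
    (@normr_ge0 _ _) (integrableR_norm ix) bnd).
rewrite -derive1E (differentiation_under_integral measurableT Ixi (fun t _ => fi t) der
    (@normr_ge0 _ _) (integrableR_norm ix) bnd).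
by apply: eq_Rintegral => x _; exact: pE.
Qed.

Lemma is_derive_re_char xi : is_derive xi (1 : R) (re_char mu) (re_char_diff xi).
Proof.
have -> : re_char_diff xi = \int[mu]_x (- (x * sin (xi * x))).
  rewrite /re_char_diff -mulN1r -(RintegralZl _ measurableT (ixsin xi)).
  by apply: eq_Rintegral => x _; rewrite mulN1r.
apply: (is_derive_under_integral (f := fun t x => cos (t * x))
  (f' := fun t x => - (x * sin (t * x)))) => // t x.
  have dt := is_derive1M (is_derive_id t (1 : R)) (is_derive_cst x t (1 : R)).
  apply: (is_derive_eq (is_derive1_compose (x := t) (is_derive_cos _) dt)).
  by rewrite /cst; ring.
by rewrite normrN normrM ler_piMr // normr_sin_le1.
Qed.

Lemma is_derive_im_char xi : is_derive xi (1 : R) (im_char mu) (im_char_diff xi).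
Proof.
apply: (is_derive_under_integral (f := fun t x => sin (t * x))
  (f' := fun t x => x * cos (t * x))) => // t x.
  have dt := is_derive1M (is_derive_id t (1 : R)) (is_derive_cst x t (1 : R)).
  apply: (is_derive_eq (is_derive1_compose (x := t) (is_derive_sin _) dt)).
  by rewrite /cst; ring.
by rewrite normrM ler_piMr // normr_cos_le1.
Qed.

(** The two brackets are the defects of [ode_im] and [ode_re]; varying the phase th separates
    them. *)
Lemma Rintegral_stein_trig n a b xi th :
  \int[mu]_x stein_tower n a b (trig_tower xi th) x =
  cos th * ((re_symbol n a).[xi] * im_char_diff xi + (im_symbol n a).[xi] * re_char_diff xi -
    ((re_symbol n b).[xi] * re_char mu xi - (im_symbol n b).[xi] * im_char mu xi)) +
  sin th * ((re_symbol n a).[xi] * re_char_diff xi - (im_symbol n a).[xi] * im_char_diff xi +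
    ((re_symbol n b).[xi] * im_char mu xi + (im_symbol n b).[xi] * re_char mu xi)).
Proof.
pose A := (re_symbol n a).[xi]; pose B := (im_symbol n a).[xi].
pose C := (re_symbol n b).[xi]; pose D := (im_symbol n b).[xi].
have E x : stein_tower n a b (trig_tower xi th) x =
    (A * cos th - B * sin th) * (x * cos (xi * x)) +
    - (A * sin th + B * cos th) * (x * sin (xi * x)) +
    (- (C * cos th - D * sin th) * cos (xi * x) +
    (C * sin th + D * cos th) * sin (xi * x)).
  rewrite /A /B /C /D !re_symbolE !im_symbolE /stein_tower.
  elim: n {A B C D} => [|n IH]; first by rewrite !big_ord0; ring.
  rewrite !big_ord_recr /= IH /trig_tower (cosD (xi * x + th)) (cosD (xi * x)) (sinD (xi * x)).
  by ring.
under eq_Rintegral do rewrite E.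
have j1 := integrableRZ (A * cos th - B * sin th) measurableT (ixcos xi).
have j2 := integrableRZ (- (A * sin th + B * cos th)) measurableT (ixsin xi).
have j3 := integrableRZ (- (C * cos th - D * sin th)) measurableT (icos xi).
have j4 := integrableRZ (C * sin th + D * cos th) measurableT (isin xi).
rewrite (RintegralD measurableT (integrableRD measurableT j1 j2) (integrableRD measurableT j3 j4)).
rewrite (RintegralD measurableT j1 j2) (RintegralD measurableT j3 j4).
rewrite (RintegralZl _ measurableT (ixcos xi)) (RintegralZl _ measurableT (ixsin xi)).
rewrite (RintegralZl _ measurableT (icos xi)) (RintegralZl _ measurableT (isin xi)).
rewrite /re_char_diff /im_char_diff /re_char /im_char -/A -/B -/C -/D; ring.
Qed.

Lemma stein_trig_odeP n a b :
  (forall xi th, stein_identity mu n a b (trig_tower xi th)) <->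
  (forall xi, ode_re n a b (re_char mu) (im_char mu) re_char_diff im_char_diff xi /\
              ode_im n a b (re_char mu) (im_char mu) re_char_diff im_char_diff xi).
Proof.
split=> [T xi|E xi th].
  have := T xi 0; have := T xi (pi / 2).
  rewrite /stein_identity !Rintegral_stein_trig cos0 sin0 cos_pihalf sin_pihalf.
  by rewrite /ode_re /ode_im; split; lra.
have [E1 E2] := E xi.
by rewrite /stein_identity Rintegral_stein_trig E2 E1 subrr addNr !mulr0 addr0.
Qed.

Lemma stein_schwartz_odeP n a b :
  (forall h : R -> R, schwartz h -> stein_identity mu n a b (fun k => h^`(k)%classic)) <->
  (forall xi, ode_re n a b (re_char mu) (im_char mu) re_char_diff im_char_diff xi /\
              ode_im n a b (re_char mu) (im_char mu) re_char_diff im_char_diff xi).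
Proof.
rewrite -stein_trig_odeP; split=> [S xi th|T h sh].
  apply: (@stein_poly_growth _ mu 0) => //.
  - by apply: (integrableR_norm ix).
  - exact: derivative_trig_tower.
  - move=> k; exists (`|xi| ^+ k) => x.
    rewrite normrM normrX ler_wpM2l ?exprn_ge0 //.
    by apply: le_trans (normr_cos_le1 _) _; rewrite expr0 lerDl.
exact: stein_trig_schwartz ix T (schwartz_tower sh) (schwartz_decaying sh).
Qed.

End integrable_law.

Variables (n : nat) (a b : nat -> R).
Hypothesis abn : forall k, (n <= k)%N -> a k = 0 /\ b k = 0.
Hypothesis ab0 : exists k, ~~ ((a k == 0) && (b k == 0)).
Variables (mu : probability R R) (c' s' : R -> R).
Hypothesis dc : forall xi, is_derive xi (1 : R) (re_char mu) (c' xi).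
Hypothesis ds : forall xi, is_derive xi (1 : R) (im_char mu) (s' xi).
Hypothesis ode : forall xi, ode_re n a b (re_char mu) (im_char mu) c' s' xi /\
                            ode_im n a b (re_char mu) (im_char mu) c' s' xi.

(** The exponent of the largest power of i xi common to A and B. *)
Let m := ex_minn ab0.
Let a' k := a (k + m)%N.
Let b' k := b (k + m)%N.

Let abm k : (k < m)%N -> a k = 0 /\ b k = 0.
Proof.
rewrite /m; case: ex_minnP => j _ min kj.
have /negPn/andP[/eqP -> /eqP ->] : ~~ ~~ ((a k == 0) && (b k == 0)).
  by apply/negP => /min; rewrite leqNgt kj.
by [].
Qed.

Let ab'0 : a' 0 != 0 \/ b' 0 != 0.
Proof.
rewrite /a' /b' add0n /m; case: ex_minnP => j + _.
by rewrite negb_and => /orP.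
Qed.

Let n_gt0 : (0 < n)%N.
Proof.
rewrite lt0n; apply/eqP => n0.
by have [k] := ab0; have [-> ->] := abn (k := k) ltac:(by rewrite n0); rewrite eqxx.
Qed.

Let ode' xi : ode_re n a' b' (re_char mu) (im_char mu) c' s' xi /\
              ode_im n a' b' (re_char mu) (im_char mu) c' s' xi.
Proof. exact: (ode_shift dc ds abm abn ode). Qed.

(** At 0 the imaginary part of the equation reads a'_0 s'(0) = b'_0, so that a'_0 = 0 would force
    b'_0 = 0, against the choice of m. *)
Let a'0 : a' 0 != 0.
Proof.
case: ab'0 => // b'0; apply: contra b'0 => /eqP a'0.
have [_] := ode' 0; rewrite /ode_im -(prednK n_gt0) !re_symbol0 !im_symbol0 re_char0.
by rewrite a'0 !mul0r mulr1 subr0 addr0 => <-.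
Qed.

Lemma ode_integrable : mu.-integrable setT (EFin \o (fun x : R => x)).
Proof.
have E xi := ode' xi; rewrite -(prednK n_gt0) in E.
have [K HK] := ode_second_difference dc ds E a'0 (re_char0 mu) (im_char0 mu).
exact: (@integrable_second_difference _ mu K).
Qed.

Let c'E xi : c' xi = re_char_diff mu xi.
Proof.
have [_ <-] := dc xi; have [_ <-] := is_derive_re_char ode_integrable xi.
by [].
Qed.

Let s'E xi : s' xi = im_char_diff mu xi.
Proof.
have [_ <-] := ds xi; have [_ <-] := is_derive_im_char ode_integrable xi.
by [].
Qed.

Lemma ode_stein (h : R -> R) : schwartz h ->
  stein_identity mu n a b (fun k => h^`(k)%classic).
Proof.
apply: (stein_schwartz_odeP ode_integrable n a b).2 => xi.
by have := ode xi; rewrite /ode_re /ode_im c'E s'E.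
Qed.

(** The power of i xi is cancelled on the equation, hence the round trip of nu from Stein identity
    to equation and back. Both laws then satisfy the reduced identity and have equal moments. *)
Lemma stein_unique nu (A : set R) :
  nu.-integrable setT (EFin \o (fun x : R => x)) ->
  (forall h : R -> R, schwartz h -> stein_identity nu n a b (fun k => h^`(k)%classic)) ->
  measurable A -> nu A = mu A.
Proof.
move=> inu Snu.
have odenu := (stein_schwartz_odeP inu n a b).1 Snu.
have odenu' := ode_shift (is_derive_re_char inu) (is_derive_im_char inu) abm abn odenu.
have Snu' := (stein_schwartz_odeP inu n a' b').2 odenu'.
have imu := ode_integrable.
have Smu' : forall h : R -> R, schwartz h -> stein_identity mu n a' b' (fun k => h^`(k)%classic).
  apply: (stein_schwartz_odeP imu n a' b').2 => xi.
  by have := ode' xi; rewrite /ode_re /ode_im c'E s'E.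
have [s s0 ies] := exponential_moment inu a'0 n_gt0 Snu'.
have [t t0 iet] := exponential_moment imu a'0 n_gt0 Smu'.
pose r := Num.min s t.
have r0 : 0 < r by rewrite lt_min s0.
have ier (P : probability R R) q : r <= q ->
    P.-integrable setT (EFin \o (fun x : R => expR (q * `|x|))) ->
    P.-integrable setT (EFin \o (fun x : R => expR (r * `|x|))).
  move=> rq ie; apply: (integrable_le _ _ ie) => //.
    by apply: measurableT_comp => //; exact: measurable_funM.
  by move=> x _; rewrite ger0_norm ?expR_ge0 // ler_expR ler_wpM2r.
have ienu : nu.-integrable setT (EFin \o (fun x : R => expR (r * `|x|))).
  by apply: ier ies; rewrite ge_min lexx.
have iemu : mu.-integrable setT (EFin \o (fun x : R => expR (r * `|x|))).
  by apply: ier iet; rewrite ge_min lexx orbT.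
have E := cos_moment_eq r0 ienu iemu (moments_eq n_gt0 a'0 inu imu Snu' Smu').
(* The phases 0 and - pi / 2, with j = 0, give the cosine and sine integrals. *)
apply: measure_eq_of_trig => xi.
  have := E xi 0%N 0; rewrite /cos_moment.
  by under eq_Rintegral do rewrite expr0 mul1r addr0; under [RHS]eq_Rintegral do rewrite expr0 mul1r addr0.
have := E xi 0%N (- (pi / 2)); rewrite /cos_moment.
by under eq_Rintegral do rewrite expr0 mul1r cosBpihalf; under [RHS]eq_Rintegral do rewrite expr0 mul1r cosBpihalf.
Qed.

End laws.

(** * Random variables *)

Section zero_extension.
Context {R : realType}.

(** Coefficients indexed by all naturals give A and B a common length and can be shifted without
    casts between ordinals. *)
Definition zero_ext d (a : 'I_d.+1 -> R) (k : nat) : R := oapp a 0 (insub k).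

Lemma zero_ext_ord d (a : 'I_d.+1 -> R) (k : 'I_d.+1) : zero_ext a k = a k.
Proof. by rewrite /zero_ext valK. Qed.

Lemma zero_ext_ge d (a : 'I_d.+1 -> R) k : (d.+1 <= k)%N -> zero_ext a k = 0.
Proof. by move=> dk; rewrite /zero_ext insubN // -leqNgt. Qed.

Lemma sum_zero_ext (V : nmodType) d n (a : 'I_d.+1 -> R) (H : R -> nat -> V) :
  (d.+1 <= n)%N -> (forall k, H 0 k = 0) ->
  \sum_(k < n) H (zero_ext a k) k = \sum_(k < d.+1) H (a k) k.
Proof.
move=> dn H0.
transitivity (\sum_(k < d.+1) H (zero_ext a k) k); last first.
  by apply: eq_bigr => k _; rewrite zero_ext_ord.
rewrite [RHS](big_ord_widen _ (fun k => H (zero_ext a k) k) dn) [RHS]big_mkcond /=.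
by apply: eq_bigr => k _; case: ltnP => // dk; rewrite zero_ext_ge.
Qed.

Variables (d d' : nat) (a : 'I_d.+1 -> R) (b : 'I_d'.+1 -> R).

Definition common_order := (maxn d d').+1.

Lemma symbol_csymbol e (c : 'I_e.+1 -> R) (z : R[i]) : (e.+1 <= common_order)%N ->
  symbol c z = csymbol common_order (zero_ext c) z.
Proof.
move=> en; rewrite /csymbol (@sum_zero_ext _ _ _ c (fun x k => x%:C * z ^+ k)) // => k.
by rewrite mul0r.
Qed.

Lemma stein_op_tower (f : R -> R) (x : R) :
  stein_op a b f x =
  stein_tower common_order (zero_ext a) (zero_ext b) (fun k => f^`(k)%classic) x.
Proof.
rewrite /stein_op /diff_op /stein_tower.
under [RHS]eq_bigr do rewrite mulrBl; rewrite sumrB.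
rewrite (@sum_zero_ext _ _ _ a (fun r k => r * x * f^`(k)%classic x)); last 2 first.
- by rewrite ltnS leq_maxl.
- by move=> k; rewrite !mul0r.
rewrite (@sum_zero_ext _ _ _ b (fun r k => r * f^`(k)%classic x)); last 2 first.
- by rewrite ltnS leq_maxr.
- by move=> k; rewrite mul0r.
by congr (_ - _); rewrite mulr_sumr; apply: eq_bigr => k _; ring.
Qed.

End zero_extension.

Section random_variables.
Context d (T : measurableType d) (R : realType) (P : probability T R).
Variable X : {RV P >-> R}.

Lemma integrable_distribution (g : R -> R) : measurable_fun setT g ->
  (distribution P X).-integrable setT (EFin \o g) -> P.-integrable setT (EFin \o (g \o X)).
Proof.
move=> mg /integrableP[_ ig]; apply/integrableP; split.
  by apply/measurable_EFinP; exact: measurableT_comp.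
move: ig; rewrite ge0_integral_distribution //.
by apply: measurableT_comp => //; exact/measurable_EFinP.
Qed.

Lemma expectation_distribution (g : R -> R) : measurable_fun setT g ->
  (distribution P X).-integrable setT (EFin \o g) ->
  ('E_P[fun w => g (X w)] = (\int[distribution P X]_x g x)%R%:E)%E.
Proof.
move=> mg ig; rewrite unlock EFin_Rintegral // integral_distribution //.
  exact/measurable_EFinP.
exact: integrable_distribution.
Qed.

Lemma char_funE xi :
  char_fun P X xi = re_char (distribution P X) xi +i* im_char (distribution P X) xi.
Proof.
have mxi : measurable_fun setT ( *%R xi : R -> R) by exact: measurable_funM.
have i1 : (distribution P X).-integrable setT (EFin \o (cst 1 : R -> R)).
  exact: finite_measure_integrable_cst.
rewrite /char_fun /Cexpectation /=; congr (_ +i* _).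
  rewrite (expectation_distribution (g := fun x => cos (xi * x))) //.
    exact: measurableT_comp measurable_cos mxi.
  by apply: (integrable_le _ _ i1) => // [|x _]; [exact: measurableT_comp measurable_cos mxi | exact: normr_cos_le1].
rewrite (expectation_distribution (g := fun x => sin (xi * x))) //.
  exact: measurableT_comp measurable_sin mxi.
by apply: (integrable_le _ _ i1) => // [|x _]; [exact: measurableT_comp measurable_sin mxi | exact: normr_sin_le1].
Qed.

Lemma integrable_law_id : ('E_P[fun w => `|X w|%R] < +oo)%E ->
  (distribution P X).-integrable setT (EFin \o (fun x : R => x)).
Proof.
rewrite unlock => H; apply/integrableP; split; first exact/measurable_EFinP.
rewrite ge0_integral_distribution //.
by apply/measurable_EFinP; exact: normr_measurable.
Qed.

Lemma expectation_stein_op d1 d2 (a : 'I_d1.+1 -> R) (b : 'I_d2.+1 -> R) (f : R -> R) :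
  (distribution P X).-integrable setT (EFin \o (fun x : R => x)) -> schwartz f ->
  ('E_P[fun w => stein_op a b f (X w)] =
  (\int[distribution P X]_x
     stein_tower (common_order d1 d2) (zero_ext a) (zero_ext b) (fun k => f^`(k)%classic) x)%R%:E)%E.
Proof.
move=> ix sf.
have -> : (fun w => stein_op a b f (X w)) = (fun w =>
    stein_tower (common_order d1 d2) (zero_ext a) (zero_ext b) (fun k => f^`(k)%classic) (X w)).
  by apply/funext => w; rewrite stein_op_tower.
have i : (distribution P X).-integrable setT (EFin \o
   stein_tower (common_order d1 d2) (zero_ext a) (zero_ext b) (fun k => f^`(k)%classic)).
  apply: integrableR_sum => // k.
  exact: integrable_stein_term ix (schwartz_tower sf) (schwartz_decaying sf).
by rewrite expectation_distribution //; exact: integrable_EFin_measurable i.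
Qed.

End random_variables.

Theorem lemma2p1 (R : realType) (d d' : nat)
    (a : 'I_d.+1 -> R) (b : 'I_d'.+1 -> R)
    (ab_neq0 : ~ ((forall k, a k = 0) /\ (forall k, b k = 0)))
    (dF : measure_display) (TF : measurableType dF) (P : probability TF R)
    (F : {RV P >-> R})
    (phiF_diff : forall xi : R, Cderivable (char_fun P F) xi)
    (phiF_ode : forall xi : R,
       symbol a ('i%C * xi%:C) * Cderive (char_fun P F) xi =
       'i%C * symbol b ('i%C * xi%:C) * char_fun P F xi)
    (dY : measure_display) (TY : measurableType dY) (Q : probability TY R)
    (Y : {RV Q >-> R})
    (Y_int : ('E_Q[fun w => `|Y w|%R] < +oo)%E) :
  (same_law Q P Y F <->
   (forall f : R -> R, schwartz f ->
      ('E_Q[fun w => (Y w * diff_op a f (Y w) - diff_op b f (Y w))%R] = 0)%E)) /\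
  is_stein_operator P F (stein_op a b) (@schwartz R).
Proof.
pose mu : probability R R := distribution P F.
pose nu : probability R R := distribution Q Y.
have reE : (fun t => complex.Re (char_fun P F t)) = re_char mu.
  by apply/funext => t; rewrite char_funE.
have imE : (fun t => complex.Im (char_fun P F t)) = im_char mu.
  by apply/funext => t; rewrite char_funE.
have dre xi : is_derive xi (1 : R) (re_char mu) ((re_char mu)^`()%classic xi).
  by have [h _] := phiF_diff xi; rewrite reE in h; apply: DeriveDef h _; rewrite derive1E.
have dim xi : is_derive xi (1 : R) (im_char mu) ((im_char mu)^`()%classic xi).
  by have [_ h] := phiF_diff xi; rewrite imE in h; apply: DeriveDef h _; rewrite derive1E.
pose n := common_order d d'.
have abn k : (n <= k)%N -> zero_ext a k = 0 /\ zero_ext b k = 0.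
  move=> nk; split; apply: zero_ext_ge; apply: leq_trans nk; rewrite ltnS.
    exact: leq_maxl.
  exact: leq_maxr.
have ab0 : exists k, ~~ ((zero_ext a k == 0) && (zero_ext b k == 0)).
  apply: contrapT => H; apply: ab_neq0.
  have H' k : zero_ext a k = 0 /\ zero_ext b k = 0.
    have : ~~ ~~ ((zero_ext a k == 0) && (zero_ext b k == 0)).
      by apply/negP => h; apply: H; exists k.
    by move=> /negPn/andP[/eqP -> /eqP ->].
  by split=> k; rewrite -zero_ext_ord; have [] := H' k.
have ode xi : ode_re n (zero_ext a) (zero_ext b) (re_char mu) (im_char mu)
      (re_char mu)^`()%classic (im_char mu)^`()%classic xi /\
    ode_im n (zero_ext a) (zero_ext b) (re_char mu) (im_char mu)
      (re_char mu)^`()%classic (im_char mu)^`()%classic xi.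
  apply/ode_complexP; have := phiF_ode xi.
  rewrite /Cderive reE imE char_funE !(@symbol_csymbol _ d d') //.
    by rewrite ltnS leq_maxr.
  by rewrite ltnS leq_maxl.
have imu := ode_integrable abn ab0 dre dim ode.
have inu := integrable_law_id Y_int.
have Smu := ode_stein abn ab0 dre dim ode.
(* The Stein operator claim is the identity for the law of F, whose mean is finite by [imu]. *)
split; last first.
  by move=> f sf; rewrite (expectation_stein_op _ _ imu sf) Smu.
split=> [YF f sf|S A mA].
  rewrite (expectation_stein_op _ _ inu sf); congr (_%:E).
  rewrite -(Smu f sf); congr fine.
  (* The same law gives the same integrals, so the identity of F transfers to Y. *)
  by apply: eq_measure_integral => A mA _; exact: YF.
apply: (stein_unique abn ab0 dre dim ode inu _ mA) => f sf.
(* As Y has finite mean, the extended expectation is a real number, and its vanishing is the real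
   Stein identity. *)
have := S f sf; rewrite (expectation_stein_op a b inu sf).
by move=> [].
Qed.
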